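(* Let $n\ge1$ and let $\mathcal I$ be an ordered and $n$-normalized fair division instance with $n$ agents. Let $T=(\tau_1,\dots,\tau_n)$ with $\tau_i=\max\left(\frac{2n}{2n+i-1},\frac34+\frac1{12n}\right)$ for all $i\in[n]$. Sample $k$ uniformly at random from $[n]$, and let agent $i$'s priority rank be $i+k-1$ if $i+k-1\le n$ and $i+k-1-n$ otherwise. Then the (random) allocation $A$ output by $\mathtt{RBF}(\mathcal I,T)$, run with these priority ranks, is ex-post $\left(\frac34+\frac1{12n}\right)$-MMS and ex-ante $\beta$-MMS, where $\beta=2\ln\left(\frac43\right)+\frac14+\frac1{36n}$. That is, for every agent $i$: $v_i(A_i)\ge\left(\frac34+\frac1{12n}\right)\mathrm{MMS}_i$ for every realization of $k$, and $\mathbb{E}_k[v_i(A_i)]\ge\beta\cdot\mathrm{MMS}_i$.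
   Context: Write $[t]=\{1,\dots,t\}$. A fair division instance consists of agents $[n]$, goods $[m]$, and additive valuations $v_i:2^{[m]}\to\mathbb{R}_{\ge0}$ (we write $v_i(g)$ for $v_i(\{g\})$). $\mathrm{MMS}_i$ is the maximum, over partitions $(P_1,\dots,P_n)$ of $[m]$, of $\min_j v_i(P_j)$. The instance is ordered if $v_i(1)\ge v_i(2)\ge\dots\ge v_i(m)$ for all $i$, and $n$-normalized if for every agent $i$ there is a partition $(P_1,\dots,P_n)$ of $[m]$ with $v_i(P_j)=1$ for all $j$ (so $\mathrm{MMS}_i=1$). Allocations may be partial, i.e. consist of pairwise disjoint bundles not covering all goods. For a finite set $S$ of positive integers, $\#(S,j)$ is the $j$-th smallest element of $S$, and $\#(S,J)=\{\#(S,j): j\in J,\ j\le|S|\}$. Algorithm $\mathtt{RBF}(\mathcal I,T)$. Input: an ordered, $n$-normalized instance with goods $[m]$, thresholds $1\ge\tau_1\ge\dots\ge\tau_n>0$, and a bijective assignment of priority ranks in $[n]$ to agents. Below, agents are renamed so that the agent with priority rank $i$ is called agent $i$. Phase 1 (reductions). Start with $N=[n]$, $M=[m]$. While $N\ne\emptyset$ and $M\neq\emptyset$: let $S_1=\#(M,\{1\})$, $S_2=\#(M,\{|N|,|N|+1\})$, $S_3=\#(M,\{2|N|-1,2|N|,2|N|+1\})$, $S_4=\#(M,\{1,2|N|+1\})$. Find the lexicographically smallest pair $(k,i)\in[4]\times N$ with $v_i(S_k)\ge\tau_i$. If it exists, give $S_k$ to agent $i$ (a type-$k$ reduction) and replace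 $N$ by $N\setminus\{i\}$ and $M$ by $M\setminus S_k$; otherwise end phase 1. Phase 2 (bag filling). With the remaining $N$ and $M$ (it always holds that $|M|\ge2|N|$), form bags $B_j=\{\#(M,j),\#(M,2|N|+1-j)\}$ for $j=1,\dots,|N|$. While some agent is unsatisfied: if some unsatisfied agent $i$ has $v_i(B_k)\ge\tau_i$ for some unassigned bag $B_k$, take the smallest such $i$, give her such a bag, and mark her satisfied; otherwise, if there are unassigned goods outside the bags, add the one with smallest index (most valuable) to an arbitrary unassigned bag; otherwise, allocate the remaining bags arbitrarily to the unsatisfied agents and stop. Arbitrary choices are resolved by any fixed rule. *)

(* Defs.v *)
From HB Require Import structures.
From mathcomp Require Import all_boot all_order all_algebra all_fingroup.

Set Implicit Arguments.
Unset Strict Implicit.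
Unset Printing Implicit Defensive.

Import Order.TTheory GRing.Theory Num.Theory.
Local Open Scope ring_scope.

(* Agents, priority ranks and bags are elements of 'I_n and goods are elements
   of 'I_m, hence numbered from 0: the element i of 'I_n stands for i.+1 in [n].
   The positions j in #(S, j), on the other hand, are natural numbers counted
   from 1. *)

Section Instance.
Variables (R : realFieldType) (n m : nat).

Definition additive_valuation (vi : {set 'I_m} -> R) : Prop :=
  (forall S, 0 <= vi S) /\ (forall S, vi S = \sum_(g in S) vi [set g]).

(* An n-tuple of pairwise disjoint, possibly empty, bundles covering [m]. *)
Definition is_partition (P : {ffun 'I_n -> {set 'I_m}}) : bool :=
  (\bigcup_j P j == [set: 'I_m]) &&
  [forall i, forall j, (i != j) ==> [disjoint P i & P j]].

(* For n > 0 and an additive valuation the two default values are harmless: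
   vi (P j) is at most vi [set: 'I_m], and every minimum is nonnegative. *)
Definition MMS (vi : {set 'I_m} -> R) : R :=
  \big[Num.max/0]_(P : {ffun 'I_n -> {set 'I_m}} | is_partition P)
    \big[Num.min/vi [set: 'I_m]]_(j < n) vi (P j).

Definition ordered (v : 'I_n -> {set 'I_m} -> R) : Prop :=
  forall i (g h : 'I_m), (g <= h)%N -> v i [set h] <= v i [set g].

Definition normalized (v : 'I_n -> {set 'I_m} -> R) : Prop :=
  forall i, exists P : {ffun 'I_n -> {set 'I_m}},
    is_partition P /\ forall j, v i (P j) = 1.

End Instance.

(* #(S, J): g is the j-th smallest element of S when g is in S and exactly j
   elements of S are at most g.  Positions j > #|S| contribute nothing. *)
Definition smallest (m : nat) (S : {set 'I_m}) (J : seq nat) : {set 'I_m} :=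
  [set g in S | #|[set h in S | (h <= g)%N]| \in J].

Section Reductions.
Variables (R : realFieldType) (n m : nat).
Variables (v : 'I_n -> {set 'I_m} -> R) (tau : 'I_n -> R).

Record state1 := State1 {
  agents1 : {set 'I_n};                 (* N *)
  goods1 : {set 'I_m};                  (* M *)
  alloc1 : {ffun 'I_n -> {set 'I_m}} }.

(* The element k of 'I_4 stands for S_(k.+1). *)
Definition reduction_bundle (N : {set 'I_n}) (M : {set 'I_m}) (k : 'I_4) :
    {set 'I_m} :=
  let c := #|N| in
  smallest M (nth [::] [:: [:: 1];
                           [:: c; c + 1];
                           [:: 2 * c - 1; 2 * c; 2 * c + 1];
                           [:: 1; 2 * c + 1]]%N k).

Definition reducible (s : state1) (p : 'I_4 * 'I_n) : bool :=
  (p.2 \in agents1 s) &&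
  (tau p.2 <= v p.2 (reduction_bundle (agents1 s) (goods1 s) p.1)).

Definition lex_le (p q : 'I_4 * 'I_n) : bool :=
  (p.1 < q.1)%N || ((p.1 == q.1) && (p.2 <= q.2)%N).

(* One iteration of the loop; the identity once the loop has ended. *)
Definition step1 (s : state1) : state1 :=
  let: State1 N M A := s in
  if (N == set0) || (M == set0) then s else
  if [pick p | reducible s p && [forall q, reducible s q ==> lex_le p q]]
    is Some (k, i) then
    let S := reduction_bundle N M k in
    State1 (N :\ i) (M :\: S) [ffun j => if j == i then S else A j]
  else s.

(* Every effective iteration removes an agent, so n iterations suffice. *)
Definition phase1 : state1 :=
  iter n step1 (State1 [set: 'I_n] [set: 'I_m] [ffun=> set0]).

End Reductions.

Section BagFilling.
Variables (R : realFieldType) (n m : nat).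
Variables (v : 'I_n -> {set 'I_m} -> R) (tau : 'I_n -> R).

Record state2 := State2 {
  unsat : {set 'I_n};                   (* unsatisfied agents *)
  open_bags : {set 'I_n};               (* indices of the unassigned bags *)
  bags : {ffun 'I_n -> {set 'I_m}};
  spare : {set 'I_m};                   (* unassigned goods outside the bags *)
  alloc2 : {ffun 'I_n -> {set 'I_m}} }.

(* A resolution of the arbitrary choices: choose_bag s C is the bag selected in
   state s from a set C of eligible bags, and heir s j is the unsatisfied agent
   who receives the unassigned bag j when the goods are exhausted (several bags
   may have the same heir).  No state occurs twice in a run, so rules depending
   on the whole history of the run would not be more general. *)
Record choice_rule := ChoiceRule {
  choose_bag : state2 -> {set 'I_n} -> 'I_n;
  heir : state2 -> 'I_n -> 'I_n;
  choose_bagP : forall s C, C != set0 -> choose_bag s C \in C;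
  heirP : forall s j, unsat s != set0 -> heir s j \in unsat s }.

Variable rule : choice_rule.

(* The bags are numbered from 0: the index j < #|N| stands for B_(j.+1). *)
Definition init2 (s : state1 n m) : state2 :=
  let: State1 N M A := s in
  let B := [ffun j : 'I_n => smallest M [:: j.+1; 2 * #|N| - j]%N] in
  let C := [set j : 'I_n | (j < #|N|)%N] in
  State2 N C B (M :\: \bigcup_(j in C) B j) A.

Definition acceptable (s : state2) (i : 'I_n) : {set 'I_n} :=
  [set k in open_bags s | tau i <= v i (bags s k)].

Definition can_receive (s : state2) (i : 'I_n) : bool :=
  (i \in unsat s) && (acceptable s i != set0).

(* One iteration of the loop; the identity once all agents are satisfied. *)
Definition step2 (s : state2) : state2 :=
  let: State2 U C B G A := s in
  if U == set0 then s else
  if [pick i | can_receive s i &&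
               [forall j : 'I_n, can_receive s j ==> (i <= j)%N]]
    is Some i then
    let k := choose_bag rule s (acceptable s i) in
    State2 (U :\ i) (C :\ k) B G [ffun j => if j == i then B k else A j]
  else if G != set0 then
    let b := choose_bag rule s C in
    let g := smallest G [:: 1%N] in
    State2 U C [ffun k => if k == b then B k :|: g else B k] (G :\: g) A
  else
    State2 set0 set0 B G
      [ffun i => if i \in U then \bigcup_(k in C | heir rule s k == i) B k
                 else A i].

(* Every effective iteration decreases #|unsat s| + #|spare s|, so n + m
   iterations suffice. *)
Definition phase2 (s : state1 n m) : state2 := iter (n + m) step2 (init2 s).

End BagFilling.

(* sigma maps every agent to her priority rank, and tau and the algorithm are
   indexed by ranks.  The rule may use sigma. *)
Definition RBF (R : realFieldType) (n m : nat)
    (rule : {perm 'I_n} -> choice_rule n m)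
    (v : 'I_n -> {set 'I_m} -> R) (tau : 'I_n -> R) (sigma : {perm 'I_n}) :
    {ffun 'I_n -> {set 'I_m}} :=
  let w := fun r : 'I_n => v ((sigma^-1)%g r) in
  let A := alloc2 (phase2 w tau (rule sigma) (phase1 w tau)) in
  [ffun i => A (sigma i)].

Section Randomization.
Variables (n : nat) (k : 'I_n).

Lemma cyclic_rank_subproof (i : 'I_n) :
  ((if (i + k < n)%N then i + k else i + k - n) < n)%N.
Proof.
case: i k => i lt_i [j lt_j] /=; case: (ltnP (i + j) n) => // le_n.
by rewrite ltn_subLR // -addnS leq_add // ltnW.
Qed.

(* In 1-based numbering: i + k - 1 if this is at most n, i + k - 1 - n
   otherwise. *)
Definition cyclic_rank (i : 'I_n) : 'I_n := Ordinal (cyclic_rank_subproof i).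

Lemma cyclic_rank_inj : injective cyclic_rank.
Proof.
have E (i : 'I_n) : val (cyclic_rank i) = ((i + k) %% n)%N.
  have /= := cyclic_rank_subproof i.
  case: (ltnP (i + k) n) => [/modn_small-> // | le_n lt_n].
  by rewrite -[in RHS](subnK le_n) modnDr modn_small.
move=> i j /(congr1 val); rewrite !E => /eqP.
by rewrite eqn_modDr !modn_small // => /eqP/val_inj.
Qed.

Definition priority : {perm 'I_n} := perm cyclic_rank_inj.

End Randomization.

Section Guarantees.
Variables (R : realFieldType) (n m : nat) (v : 'I_n -> {set 'I_m} -> R).

(* A k is the realization of the random allocation for the outcome k, the
   outcome being uniformly distributed over 'I_n. *)
Variable A : 'I_n -> {ffun 'I_n -> {set 'I_m}}.

Definition ex_post_MMS (alpha : R) : Prop :=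
  forall k i, alpha * MMS n (v i) <= v i (A k i).

Definition ex_ante_MMS (beta : R) : Prop :=
  forall i, beta * MMS n (v i) <= (\sum_(k < n) v i (A k i)) / n%:R.

End Guarantees.

(* With i counted from 0, 2n + i - 1 becomes 2n + i. *)
Definition threshold (R : realFieldType) (n : nat) (i : 'I_n) : R :=
  Num.max ((2 * n)%:R / (2 * n + i)%:R) (3 / 4 + 1 / (12 * n)%:R).

(* Main.v *)
Require Import Defs.
From HB Require Import structures.
From mathcomp Require Import all_boot all_order all_algebra all_fingroup.
From mathcomp Require Import reals exp.
From mathcomp Require Import zify ring lra.
Set Implicit Arguments.
Unset Strict Implicit.
Unset Printing Implicit Defensive.
Import Order.TTheory GRing.Theory Num.Theory.
Local Open Scope ring_scope.

(* Every agent of priority rank r receives at least tau_r.  Since the rank of an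
   agent is uniform, her expected value is then at least the average of the
   thresholds, a left Riemann sum of the nonincreasing function
   max(2/(2+x), 3/4 + 1/(12n)) on [0, 1]; and MMS <= 1.

   Suppose agent a gets nothing worth tau = tau_a.

   If tau = 2n/(2n+r-1), bound the value, to a, of what the others take: less
   than tau for an agent that a precedes, since a passed on the bundle, and at
   most 3/2 tau for an agent that precedes a.  The total stays below
   tau (n + (r-1)/2) = n, a contradiction.  A type-2 reduction may exceed
   3/2 tau, but only directly after a type-3 reduction, and the excess is made
   up for by this reduction or by the next one.

   If tau = 3/4 + d with d = 1/(12n), follow a's partition into bundles of value
   1 through phase 1: a reduction of type 1, 2 or 3 destroys one bundle, and one
   of type 4 merges two bundles, losing at most 1 + 4d/3 in total.  Values are
   lowered on the way so that no bundle is worth more than 1.  In phase 2, if no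
   initial bag is worth more than 1, each final bag is worth at most 1 + 4d/3,
   which is too little.  Otherwise a large good leaves no room for two further ones in its
   bundle and the goods outside the initial bags are small; the excess of the
   bags worth more than 1 is compensated by the bags of medium goods, which are
   worth little on average or are topped up by small goods only. *)

(** * Bag filling with slack beyond 3/4 *)

(* [o] counts the partners of large goods that lie outside the bundles of the
   large goods, [f] the medium bags that were topped up.  The first bound on the
   total is good when [f] is large, the second when it is small; a positive
   combination of the two eliminates [f]. *)
Lemma mixed_bound_absurd_mid (R : realFieldType) (d D e x o f : R) :
  0 <= d -> d <= 1/24 -> 0 <= x -> 0 <= e -> e + x <= 1/12 + d ->
  0 <= D -> D <= 1/9 - 8/3 * d -> 0 <= f -> (o = 0 \/ 1 <= o) ->
  let E := 1/4 - d in let a := E + 4 * d - x - 2 * e in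
  - D <= o * e - f * (E - x) - E -> - D <= - (o * (E + x)) + f * a + a - x ->
  False.
Proof.
move=> d0 d1 x0 e0 ex D0 D1 f0 o01 E a h1 h2.
have Ex : 0 < E - x by rewrite /E; lra.
have a0 : 0 < a by rewrite /a /E; lra.
case: o01 => [o0|o1].
  have : 0 <= f * (E - x) by apply: mulr_ge0 => //; lra.
  by move: h1; rewrite o0 /E; lra.
(* The weights [a] and [E - x] cancel [f] in the sum of the two bounds; with [1 <= o], what is left
   contradicts [Q1]. *)
have k1 : 0 <= a * (o * e - f * (E - x) - E + D) by apply: mulr_ge0; lra.
have k2 : 0 <= (E - x) * (- (o * (E + x)) + f * a + a - x + D).
  by apply: mulr_ge0; lra.
have Q0 : 0 <= (E - x) * (E + x) - e * a by rewrite /a /E; nra.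
have Q1 : D * (a + E - x) < (E - x) * (E + x) - e * a + a * x + x * (E - x).
  have ax : a + E - x <= 1/2 - 2*x - 2 * e + 2 * d by rewrite /a /E; lra.
  have : D * (a + E - x) <= (1/9 - 8/3 * d) * (1/2 - 2*x - 2 * e + 2 * d).
    by apply: ler_pM => //; lra.
  have g1 : 0 <= x * (1/12 + d - e - x) by apply: mulr_ge0; lra.
  have g2 : 0 <= x * (1/24 - d) by apply: mulr_ge0; lra.
  have g3 : 0 <= d * (1/24 - d) by apply: mulr_ge0; lra.
  have g4 : 0 <= x * e by apply: mulr_ge0.
  (* At [x = 0] the terms with [e] are [2 e^2 - (1/36 + 25/3 d) e]; this is their completed
     square. *)
  have g5 := sqr_ge0 (4 * e - (1/36 + 25/3 * d)).
  by rewrite /a /E; lra.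
have : 0 <= (o - 1) * ((E - x) * (E + x) - e * a) by apply: mulr_ge0; lra.
by nra.
Qed.

(** Here the open bag is one of the large bags, and its shortfall [E - e] exceeds [D] by itself.
    Dropping both leaves strict bounds, and the combination that eliminates [f] contradicts [Q0]. *)
Lemma mixed_bound_absurd_top (R : realFieldType) (d D e x o f : R) :
  0 <= d -> d <= 1/24 -> 0 <= x -> 0 <= e -> e + x <= 1/12 + d ->
  D <= 1/9 - 8/3 * d -> 0 <= f -> 0 <= o ->
  let E := 1/4 - d in let a := E + 4 * d - x - 2 * e in
  - D <= o * e - f * (E - x) - (E - e) ->
  - D <= - (o * (E + x)) + f * a - (E - e) -> False.
Proof.
move=> d0 d1 x0 e0 ex D1 f0 o0 E a h1 h2.
have Ex : 0 < E - x by rewrite /E; lra.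
have a0 : 0 < a by rewrite /a /E; lra.
have k1 : 0 < a * (o * e - f * (E - x)).
  by apply: mulr_gt0 => //; move: h1; rewrite /E; lra.
have k2 : 0 < (E - x) * (- (o * (E + x)) + f * a).
  by apply: mulr_gt0 => //; move: h2; rewrite /E; lra.
have Q0 : 0 <= (E - x) * (E + x) - e * a by rewrite /a /E; nra.
have : 0 <= o * ((E - x) * (E + x) - e * a) by apply: mulr_ge0; lra.
by nra.
Qed.

Ltac nat_lia :=
  repeat match goal with
  | H : is_true (@Order.le _ _ _ _) |- _ => clear H
  | H : is_true (@Order.lt _ _ _ _) |- _ => clear H
  | H : forall _, _ |- _ => clear H
  end; lia.

Lemma big_nat_reflect (V : nmodType) (H : nat -> V) (s a b : nat) :
  (a <= b <= s)%N ->
  \sum_(s - b <= p < s - a) H p = \sum_(a <= j < b) H (s.-1 - j)%N.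
Proof.
move=> /andP[ab bs]; rewrite -[X in \sum_(X <= _ < _) H _]add0n big_addn.
rewrite -[X in _ = \sum_(X <= _ < _) _]add0n big_addn.
have -> : (s - a - (s - b) = b - a)%N by lia.
rewrite big_nat_rev /=; apply: eq_big_nat => i /andP[_ ilt].
by congr H; lia.
Qed.

Lemma big_range_ord (V : nmodType) (L a b : nat) (P : pred nat) (H : nat -> V) :
  (b <= L)%N ->
  \sum_(p < L | (a <= p < b)%N && P p) H p = \sum_(a <= p < b | P p) H p.
Proof.
move=> bL; rewrite (big_nat_widen _ _ _ _ _ bL) (big_nat_widenl _ _ _ _ _ (leq0n a)).
by rewrite big_mkord; apply: eq_bigl => p; rewrite andbC -andbA [(_ < b)%N && _]andbC.
Qed.

(* [G p] is the reduced value of the good at position p, [col p] its class, and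
   [F j] the final value of bag j.  [D] bounds the value lost in phase 1, [j0] is
   a bag that stayed open, and [kk] the last bag that starts above 1.  Below,
   [u] and [w] are the values of the two goods of bag [kk], [x] is that of the
   best good outside the initial bags, and [e] bounds by how much a bag can
   exceed 1. *)
Section MixedBags.
Variables (R : realFieldType) (I : finType) (K : {set I}) (c L : nat).
Variables (G : nat -> R) (col : nat -> I) (F : nat -> R) (d D : R) (j0 kk : nat).
Let alpha := 3 / 4 + d.
Hypotheses (cardK : #|K| = c) (colK : forall p, col p \in K).
Hypotheses (G_ge0 : forall p, 0 <= G p).
Hypothesis (G_noninc : forall p q, (p <= q)%N -> G q <= G p).
Hypothesis (class_le1 : forall l, l \in K -> \sum_(p < L | col p == l) G p <= 1).
Hypothesis (ltcL : (2 * c < L)%N).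
Hypotheses (S2lt : G c.-1 + G c < alpha) (S4lt : G 0%N + G (2 * c)%N < alpha).
Hypothesis Fcase : forall j, (j < c)%N ->
  F j = G j + G ((2 * c).-1 - j)%N \/ F j < alpha + G (2 * c)%N.
Hypotheses (j0c : (j0 < c)%N) (Fj0 : F j0 < alpha).
Hypotheses (d_ge0 : 0 <= d) (d_le : d <= 1 / 24).
Hypotheses (D_ge0 : 0 <= D) (D_le : D <= 1 / 9 - 8 / 3 * d).
Hypotheses (kkc : (kk < c)%N) (bigkk : 1 < G kk + G ((2 * c).-1 - kk)%N).
Hypothesis smallkk : forall j, (kk < j < c)%N -> G j + G ((2 * c).-1 - j)%N <= 1.

Let k := kk.+1.
Let u := G kk.
Let w := G ((2 * c).-1 - kk)%N.
Let x := G (2 * c)%N.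
Let E := 1 / 4 - d.
Let e := alpha - x + w - 1.
Let a := alpha + x - 2 * w.
Let q (j : nat) := ((2 * c).-1 - j)%N.
Let kappa := [set col t | t : 'I_k].

Lemma class_sub_le1 l (A : pred 'I_L) :
  (forall p, A p -> col p = l) -> \sum_(p < L | A p) G p <= 1.
Proof.
move=> Al; case: (pickP A) => [p Ap|A0]; last by rewrite big_pred0 ?ler01.
have lK : l \in K by rewrite -(Al _ Ap).
apply: le_trans (class_le1 lK).
rewrite [X in _ <= X](bigID A) /= [X in _ <= X + _](eq_bigl A) => [|i].
  by rewrite lerDl sumr_ge0.
by case Ai: (A i); rewrite ?andbF // (Al _ Ai) eqxx.
Qed.

Lemma two_in_class p r : (p < L)%N -> (r < L)%N -> p != r -> col p = col r ->
  G p + G r <= 1.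
Proof.
move=> pL rL pr cpr.
pose p' := Ordinal pL; pose r' := Ordinal rL.
have := @class_sub_le1 (col p) (pred2 p' r').
rewrite (bigD1 p') /= ?eqxx // (bigD1 r') /=; last first.
  by rewrite eqxx orbT /= -val_eqE /= eq_sym.
move=> h; apply: le_trans (h _); last by move=> i /orP[] /eqP ->.
by rewrite addrA lerDl sumr_ge0.
Qed.

Lemma three_in_class p r s : (p < L)%N -> (r < L)%N -> (s < L)%N ->
  p != r -> p != s -> r != s -> col r = col p -> col s = col p ->
  G p + G r + G s <= 1.
Proof.
move=> pL rL sL pr ps rs cpr cps.
pose p' := Ordinal pL; pose r' := Ordinal rL; pose s' := Ordinal sL.
have := @class_sub_le1 (col p) (pred3 p' r' s').
rewrite (bigD1 p') /= ?eqxx // (bigD1 r') /=; last first.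
  by rewrite eqxx orbT /= -val_eqE /= eq_sym.
rewrite (bigD1 s') /=; last first.
  by rewrite eqxx !orbT /= -!val_eqE /= ![s == _]eq_sym ps rs.
move=> h; apply: le_trans (h _); last by move=> i /or3P[] /eqP ->.
by rewrite !addrA lerDl sumr_ge0.
Qed.

(** If [kk] were the last bag, its two goods would form the declined type-2 bundle, worth less than
    [alpha < 1]. *)
Let k_lt_c : (k < c)%N.
Proof.
rewrite ltn_neqAle kkc andbT; apply/eqP => kc; move: bigkk.
have -> : ((2 * c).-1 - kk = c)%N by nat_lia.
have -> : kk = c.-1 by nat_lia.
by move: S2lt d_le; rewrite /alpha; lra.
Qed.

Let x_ge0 : 0 <= x. Proof. exact: G_ge0. Qed.
Let w_le_u : w <= u. Proof. by apply: G_noninc; nat_lia. Qed.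
Let uw : 1 < u + w. Proof. exact: bigkk. Qed.
Let ux : u + x < alpha.
Proof. by apply: le_lt_trans S4lt; rewrite lerD2r G_noninc. Qed.
Let top_ge t : (t < k)%N -> u <= G t.
Proof. by move=> tk; apply: G_noninc. Qed.
Let top_le t : G t <= alpha - x.
Proof. by have := G_noninc (leq0n t); move: S4lt; rewrite /x; lra. Qed.

(** Two of the first [k] goods are together worth at least [2 * u >= u + w > 1]. *)
Let kappa_inj (s t : nat) : (s < k)%N -> (t < k)%N -> col s = col t -> s = t.
Proof.
move=> sk tk cst; apply/eqP; apply: contraT => st.
have sL : (s < L)%N by nat_lia.
have tL : (t < L)%N by nat_lia.
have := two_in_class sL tL st cst.
by have := top_ge sk; have := top_ge tk; move: w_le_u uw; lra.
Qed.

Let card_kappa : #|kappa| = k.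
Proof.
rewrite card_imset ?card_ord // => s t cst.
exact: val_inj (kappa_inj (ltn_ord _) (ltn_ord _) cst).
Qed.

Let kappaK : kappa \subset K.
Proof. by apply/subsetP => l /imsetP[t _ ->]. Qed.

(** These goods are worth at least [w], so none of them fits beside a large good. *)
Let mid_notin p : (k <= p <= (2 * c).-1 - kk)%N -> col p \notin kappa.
Proof.
move=> /andP[kp pq]; apply/imsetP => -[t _ cpt].
have pL : (p < L)%N by nat_lia.
have tL : (t < L)%N by have := ltn_ord t; nat_lia.
have pt : p != t by have := ltn_ord t; nat_lia.
have := two_in_class pL tL pt cpt.
have := top_ge (ltn_ord t).
have : w <= G p by apply: G_noninc.
by move: uw; lra.
Qed.

Let card_rest : #|K :\: kappa| = (c - k)%N.
Proof. by rewrite cardsD (setIidPr kappaK) cardK card_kappa. Qed.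

(* The 2(c-k)+1 positions k, .., 2c-k avoid the k classes of the large goods,
   so three of them share one of the other c-k classes. *)
Let w_third : 3 * w <= 1.
Proof.
rewrite leNgt; apply/negP => w3.
pose b := ((2 * c).-1 - kk).+1.
pose Q (p : nat) := (k <= p < b)%N.
have cQ : (\sum_(p < L | Q p) 1 = (c - k).*2.+1)%N.
  have := @big_range_ord nat L k b xpredT (fun=> 1%N).
  under eq_bigl do rewrite andbT.
  by move=> ->; [rewrite sum_nat_const_nat; nat_lia | nat_lia].
suff : ((c - k).*2.+1 <= \sum_(l in K :\: kappa) 2)%N.
  by rewrite sum_nat_const card_rest; nat_lia.
rewrite -cQ (partition_big (fun p : 'I_L => col p) (mem (K :\: kappa))) /=; last first.
  by move=> p Qp; rewrite inE mid_notin ?colK //; move: Qp; rewrite /Q; nat_lia.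
apply: leq_sum => l _; rewrite leqNgt; apply/negP => cl.
have := @class_sub_le1 l (fun p : 'I_L => Q p && (col p == l)).
move=> /(_ (fun p h => eqP (andP h).2)); apply/negP; rewrite -ltNge.
apply: lt_le_trans w3 _.
apply: (@le_trans _ _ (\sum_(p < L | Q p && (col p == l)) w)).
  rewrite sumr_const -[w *+ _]mulr_natl; apply: ler_wpM2r; first exact: G_ge0.
  by rewrite ler_nat -sum1_card.
by apply: ler_sum => p /andP[Qp _]; apply: G_noninc; move: Qp; rewrite /Q; nat_lia.
Qed.

Let e_gt0 : 0 < e. Proof. by move: ux uw; rewrite /e; lra. Qed.
Let ex_le : e + x <= 1 / 12 + d.
Proof. by move: w_third; rewrite /e /alpha; lra. Qed.

(* The large bags that nobody topped up, with a partner good too valuable to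
   share a class with another such good. *)
Let J1 : {set 'I_k} :=
  [set j : 'I_k | [&& j != j0 :> nat, F j == G j + G (q j) & 1 - alpha <= G (q j)]].
(** Partners without a large good in their class take up room in the other [c - k] classes. *)
Let Out : {set 'I_k} := [set j in J1 | col (q j) \notin kappa].
Let o : R := #|Out|%:R.
Let Pout : R := \sum_(j in Out) G (q j).

Let partner_le (j : 'I_k) : G (q j) <= w.
Proof. by apply: G_noninc; rewrite /q; have := ltn_ord j; nat_lia. Qed.

Let Pout_le : Pout <= o * w.
Proof.
rewrite /o mulr_natl -sumr_const; apply: ler_sum => j _; exact: partner_le.
Qed.

(** The large good is worth more than [2/3] and each partner at least [1/4 - d >= 5/24], so two
    partners would overfill the class. *)
Let top_partner_unique (t j j' : 'I_k) : j \in J1 -> j' \in J1 ->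
  col (q j) = col t -> col (q j') = col t -> j = j'.
Proof.
rewrite !inE => /and3P[_ _ jp] /and3P[_ _ j'p] cj cj'.
apply/eqP; apply: contraT => jj'.
have [jk j'k tk] := And3 (ltn_ord j) (ltn_ord j') (ltn_ord t).
have jjn : (j : nat) != j' by [].
have := @three_in_class t (q j) (q j').
rewrite cj cj' => /(_ _ _ _ _ _ _ erefl erefl); rewrite /q => h.
have := h ltac:(nat_lia) ltac:(nat_lia) ltac:(nat_lia) ltac:(nat_lia) ltac:(nat_lia) ltac:(nat_lia).
move: jp j'p (top_ge tk) uw w_third d_le; rewrite /q /alpha; lra.
Qed.

(** By [kappa_inj] a partner is counted at the only large good of its class if there is one, and in
    [Out] otherwise. *)
Let J1_exchange (W : 'I_k -> R) :
  \sum_(t < k) \sum_(j in J1 | col (q j) == col t) W j + \sum_(j in Out) W j =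
  \sum_(j in J1) W j.
Proof.
rewrite (exchange_big_dep (mem J1)) /=; last by move=> ? ? _ /andP[].
rewrite [RHS](bigID (fun j : 'I_k => col (q j) \in kappa)) /=.
congr (_ + _); last by apply: eq_bigl => j; rewrite !inE.
rewrite [RHS]big_mkcondr /=; apply: eq_bigr => j jJ.
case: ifP => [/imsetP[t _ cjt]|/negP nin].
  rewrite (big_pred1 t) // => s; rewrite jJ cjt /=.
  apply/eqP/eqP => [h|-> //].
  exact: val_inj (kappa_inj (ltn_ord _) (ltn_ord _) (esym h)).
by rewrite big_pred0 // => t; rewrite jJ /=; apply/eqP => h; apply: nin; rewrite h imset_f.
Qed.

(** Bag [t] trades its own partner for the partner lying in the class of good [t], if there is one.
    For [t] in [J1] the result lies in one class, or is a single good worth at most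
    [alpha - x = 1 + e - w]. In the sum over [t] the trades cancel except for [Out]. *)
Let top_charge (t : 'I_k) :
  F t - (t \in J1)%:R * G (q t) + \sum_(j in J1 | col (q j) == col t) G (q j) <=
  1 + (e - w) * ((t \in J1)%:R - \sum_(j in J1 | col (q j) == col t) 1)
    - (j0 == t)%:R * (E - e).
Proof.
have tk := ltn_ord t.
(* Outside [J1] the bag is the open one, has a partner below [1 - alpha], or was topped up. The
   second bound adds a traded partner [p]. *)
have Ftle : t \notin J1 -> F t <= 1 - (j0 == t)%:R * E /\
    forall p, 1 - alpha <= p -> G t + p <= 1 -> p <= w ->
      F t + p <= 1 + w - e - (j0 == t)%:R * (E - e).
  rewrite inE; case: eqP => [jt _|/eqP jt] /=.
    rewrite jt eqxx !mul1r; split; first by move: Fj0 d_ge0; rewrite /alpha /E; lra.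
    by move=> p _ _ pw; move: Fj0 x_ge0; rewrite /alpha /E /e; lra.
  rewrite [j0 == t]eq_sym (negbTE jt) !mul0r !subr0.
  case: (Fcase (ltn_trans tk k_lt_c)) => [->|Flt].
    rewrite eqxx /= -ltNge => pt; split; first by move: (top_le t) pt x_ge0; rewrite /q; lra.
    by move=> p p1 p2 p3; move: pt x_ge0; rewrite /q /e; lra.
  move=> _; split; first by move: Flt ex_le e_gt0 d_le; rewrite -/x /alpha; lra.
  by move=> p _ _ pw; move: Flt w_third d_le; rewrite -/x /e /alpha; lra.
case: (pickP (fun j => (j \in J1) && (col (q j) == col t))) => [j /andP[jJ cj]|none].
  rewrite !(big_pred1 j); last 2 first.
  - by move=> i; apply/andP/eqP => [[iJ /eqP ci]|->//]; apply: (top_partner_unique iJ jJ ci (eqP cj)).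
  - by move=> i; apply/andP/eqP => [[iJ /eqP ci]|->//]; apply: (top_partner_unique iJ jJ ci (eqP cj)).
  have cls : G t + G (q j) <= 1.
    have jk := ltn_ord j.
    by apply: two_in_class; rewrite ?(eqP cj) // /q; nat_lia.
  case: (boolP (t \in J1)) => tJ.
    move: tJ; rewrite inE => /and3P[tj0 /eqP -> _].
    by rewrite [j0 == t]eq_sym (negbTE tj0) /= subrr mulr0 mul1r mul0r; move: cls; lra.
  have [_ /(_ (G (q j)))] := Ftle tJ.
  have jp : 1 - alpha <= G (q j) by move: jJ; rewrite inE => /and3P[].
  by move=> /(_ jp cls (partner_le j)); rewrite /= mul0r sub0r mulrN1; lra.
rewrite !big_pred0 //.
case: (boolP (t \in J1)) => tJ.
  move: tJ; rewrite inE => /and3P[tj0 /eqP -> _].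
  rewrite [j0 == t]eq_sym (negbTE tj0) /= subr0 mulr1 mul1r mul0r; move: (top_le t); rewrite /e; lra.
have [h _] := Ftle tJ; rewrite /= subr0 mulr0 mul0r.
by move: h e_gt0; case: (j0 == t); rewrite /= ?mul1r ?mul0r; lra.
Qed.

Let sum_at (s b : nat) (y : R) :
  \sum_(s <= j < b) (j0 == j)%:R * y = (s <= j0 < b)%N%:R * y.
Proof.
rewrite -mulr_suml; congr (_ * _); rewrite -natr_sum; congr _%:R.
case: (boolP (s <= j0 < b)%N) => jsb; last first.
  by rewrite big_nat big1 // => i ib; case: eqP => // ji; move: jsb; rewrite ji ib.
rewrite (big_rem j0) ?mem_index_iota //= eqxx big1_seq ?addn0 // => i /=.
by rewrite (mem_rem_uniq _ (iota_uniq _ _)) inE eq_sym => /andP[/negbTE ->].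
Qed.

Let top_sum : \sum_(0 <= t < k) F t <=
  k%:R + (e - w) * o + Pout - (j0 < k)%:R * (E - e).
Proof.
have := @ler_sum _ _ (index_enum 'I_k) xpredT _ _ (fun t _ => top_charge t).
have JM (W : 'I_k -> R) : \sum_(t < k) (t \in J1)%:R * W t = \sum_(j in J1) W j.
  by rewrite [RHS]big_mkcond /=; apply: eq_bigr => t _; case: (t \in J1); rewrite ?mul1r ?mul0r.
rewrite big_split /= sumrB JM.
rewrite sumrB [X in _ <= X - _]big_split /= sumr_const card_ord -mulr_sumr sumrB.
have -> : \sum_(t < k) (t \in J1)%:R = \sum_(j in J1) (1 : R).
  by rewrite -[RHS]JM; apply: eq_bigr => t _; rewrite mulr1.
have := J1_exchange (G \o q); have := J1_exchange (fun=> 1); rewrite /= -/Pout.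
have -> : \sum_(j in Out) (1 : R) = o by rewrite sumr_const.
have -> : \sum_(t < k) (j0 == t)%:R * (E - e) = (j0 < k)%:R * (E - e).
  by rewrite -(big_mkord xpredT (fun t => (j0 == t)%:R * (E - e))) sum_at.
rewrite -(big_mkord xpredT F).
move: (\sum_(t < k) \sum_(j in J1 | _) 1) (\sum_(j in J1) 1) => A B <-.
move: (\sum_(t < k) \sum_(j in J1 | _) _) (\sum_(j in J1) _) => A' B' <-.
rewrite [A + o - A]addrAC subrr add0r; lra.
Qed.

(** The goods at positions [k, .., 2c - k - 1] and the partners in [Out] are distinct and all lie in
    the [c - k] classes outside [kappa]. *)
Let rest_sum : \sum_(k <= j < c) (G j + G (q j)) + Pout <= c%:R - k%:R.
Proof.
pose H p := if col p \notin kappa then G p else 0.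
have HG p : (k <= p <= (2 * c).-1 - kk)%N -> H p = G p.
  by move=> kp; rewrite /H mid_notin.
have PoutE : Pout <= \sum_(2 * c - k <= p < 2 * c - 0) H p.
  rewrite big_nat_reflect; last by nat_lia.
  rewrite big_mkord [X in _ <= X](bigID (mem Out)) /= -[Pout]addr0 lerD //.
    rewrite le_eqVlt; apply/orP; left; apply/eqP; apply: eq_bigr => j.
    by rewrite inE => /andP[_ cj]; rewrite /H cj.
  by apply: sumr_ge0 => j _; rewrite /H; case: ifP.
have -> : \sum_(k <= j < c) (G j + G (q j)) = \sum_(k <= p < 2 * c - k) H p.
  rewrite [RHS](big_cat_nat (n := c)) /=; [|nat_lia|nat_lia].
  rewrite big_split /=; congr (_ + _).
    by apply: eq_big_nat => p pc; rewrite HG //; nat_lia.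
  have -> : \sum_(c <= p < 2 * c - k) H p = \sum_(2 * c - c <= p < 2 * c - k) H p.
    by congr (\sum_(_ <= p < _) H p); nat_lia.
  rewrite big_nat_reflect; last by nat_lia.
  by apply: eq_big_nat => p pc; rewrite /q HG //; nat_lia.
apply: (@le_trans _ _ (\sum_(k <= p < L) H p)).
  rewrite [X in _ <= X](big_cat_nat (n := (2 * c - k)%N)) /=; [|nat_lia|nat_lia].
  rewrite lerD2l; apply: le_trans PoutE _.
  rewrite [X in _ <= X](big_cat_nat (n := (2 * c - 0)%N)) /=; [|nat_lia|nat_lia].
  by rewrite lerDl sumr_ge0 // => j _; rewrite /H; case: ifP.
rewrite -natrB; last by nat_lia.
rewrite -card_rest -sumr_const.
apply: (@le_trans _ _ (\sum_(p < L | col p \notin kappa) G p)).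
  rewrite -(big_mkord (fun p => col p \notin kappa) G) [X in _ <= X]big_mkcond /=.
  rewrite [X in _ <= X](big_cat_nat (n := k)) /=; [|by []|nat_lia].
  by rewrite lerDr sumr_ge0 // => j _; case: ifP.
rewrite (partition_big (fun p : 'I_L => col p) (mem (K :\: kappa))) /=; last first.
  by move=> p; rewrite inE colK andbT.
apply: ler_sum => l; rewrite inE => /andP[lk lK].
apply: le_trans (class_le1 lK); rewrite le_eqVlt; apply/orP; left; apply/eqP.
by apply: eq_bigl => p; case: eqP => [->|]; rewrite ?andbF // lk.
Qed.

Lemma mixed_bags_absurd : c%:R - D <= \sum_(0 <= j < c) F j -> False.
Proof.
pose fl j := (j != j0) && (F j != G j + G (q j)).
pose f : R := \sum_(k <= j < c) (fl j)%:R.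
have kj0 : (k <= j0)%N = (k <= j0 < c)%N by rewrite j0c andbT.
have f_ge0 : 0 <= f by apply: sumr_ge0 => j _; case: (fl j).
have o01 : o = 0 \/ 1 <= o.
  by rewrite /o; case: #|Out| => [|m]; [left | right; rewrite ler1n].
have o_ge0 : 0 <= o by rewrite /o ler0n.
(* A topped-up bag is worth less than [alpha + x = 1 - (E - x)], and the open one less than
   [alpha = 1 - E]. *)
have mid1 : \sum_(k <= j < c) F j <=
    \sum_(k <= j < c) 1 - f * (E - x) - (k <= j0)%:R * E.
  rewrite kj0 -sum_at /f mulr_suml -!sumrB !big_nat.
  apply: ler_sum => j jc; rewrite /fl [j0 == j]eq_sym.
  have jc' : (j < c)%N by nat_lia.
  case: (eqVneq j j0) => [->|jj0] /=.
    by move: Fj0; rewrite mul1r /E /alpha; lra.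
  case: (Fcase jc') => [->|Flt].
    have kj : (kk < j < c)%N by nat_lia.
    by have := smallkk kj; rewrite /q eqxx /=; lra.
  case: eqP => [Fj|_] /=; last by move: Flt; rewrite /E /x /alpha; lra.
  have kj : (kk < j < c)%N by nat_lia.
  by have := smallkk kj; rewrite Fj /q /=; lra.
(* Over its initial value, which is at least [2 * w], a topped-up bag gains at most
   [alpha + x - 2 * w = a], and the open one at most [a - x]. *)
have mid2 : \sum_(k <= j < c) F j <=
    \sum_(k <= j < c) (G j + G (q j)) + f * a + (k <= j0)%:R * (a - x).
  rewrite kj0 -sum_at /f mulr_suml -!big_split !big_nat /=.
  apply: ler_sum => j jc; rewrite /fl [j0 == j]eq_sym.
  have jc' : (j < c)%N by nat_lia.
  have Gj : w <= G j by apply: G_noninc; nat_lia.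
  have Gqj : w <= G (q j) by apply: G_noninc; rewrite /q; nat_lia.
  case: (eqVneq j j0) => [jj|jj0] /=.
    by move: Fj0 Gj Gqj; rewrite jj mul1r mul0r /a; lra.
  case: (eqVneq (F j) (G j + G (q j))) => [->|Fj] /=; first by lra.
  case: (Fcase jc') => [Fj'|Flt]; first by move: Fj; rewrite Fj' /q eqxx.
  by move: Flt Gj Gqj; rewrite mul0r mul1r /a /x; lra.
rewrite (big_cat_nat (n := k)) /=; [|by []|exact: ltnW k_lt_c].
rewrite sumr_const_nat (natrB _ (ltnW k_lt_c)) in mid1.
move=> tot.
have aE : a = 1/4 - d + 4 * d - x - 2 * e by rewrite /a /e /alpha; lra.
have oe : (e - w) * o + Pout <= e * o by move: Pout_le; lra.
have ewE : e - w = - (1/4 - d + x) by rewrite /e /alpha; lra.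
have ts := top_sum; have [e0 [ex x0]] := (e_gt0, (ex_le, x_ge0)).
have rs := rest_sum.
have [kj|jk] := leqP k j0.
  rewrite kj /= mulr1n mul1r in mid1 mid2.
  rewrite ltnNge kj /= mulr0n mul0r subr0 in ts.
  apply: (@mixed_bound_absurd_mid R d D e x o f); rewrite ?(ltW e0) //.
    by move: mid1 ts tot oe; rewrite -/E; lra.
  by move: mid2 ts tot rs; rewrite ewE aE; lra.
rewrite [(k <= j0)%N]leqNgt jk /= mulr0n mul0r in mid1 mid2.
rewrite jk /= mulr1n mul1r in ts.
apply: (@mixed_bound_absurd_top R d D e x o f); rewrite ?(ltW e0) //.
  by move: mid1 ts tot oe; rewrite -/E; lra.
by move: mid2 ts tot rs; rewrite ewE aE /E; lra.
Qed.
End MixedBags.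

Lemma bags_total_lt (R : realFieldType) (I : finType) (K : {set I}) (c L : nat)
    (G : nat -> R) (col : nat -> I) (F : nat -> R) (d D : R) (j0 : nat) :
  #|K| = c -> (forall p, col p \in K) -> (forall p, 0 <= G p) ->
  (forall p q, (p <= q)%N -> G q <= G p) ->
  (forall l, l \in K -> \sum_(p < L | col p == l) G p <= 1) ->
  (2 * c < L)%N ->
  G c.-1 + G c < 3 / 4 + d -> 3 * G (2 * c)%N < 3 / 4 + d ->
  G 0%N + G (2 * c)%N < 3 / 4 + d ->
  (forall j, (j < c)%N -> F j = G j + G ((2 * c).-1 - j)%N \/
                          F j < 3 / 4 + d + G (2 * c)%N) ->
  (j0 < c)%N -> F j0 < 3 / 4 + d -> 0 <= d -> d <= 1 / 24 -> 0 <= D ->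
  D + c%:R * (4 / 3 * d) <= 1 / 9 ->
  \sum_(0 <= j < c) F j < c%:R - D.
Proof.
move=> cardK colK G0 Gni cls ltcL S2 S3 S4 Fc j0c Fj0 d0 d1 D0 Dc.
rewrite ltNge; apply/negP => tot.
have c0 : (0 < c)%N by apply: leq_ltn_trans j0c.
case: (boolP [exists j : 'I_c, 1 < G j + G ((2 * c).-1 - j)%N]) => [/existsP[jb jbP]|].
  have exP : exists j, (j < c)%N && (1 < G j + G ((2 * c).-1 - j)%N).
    by exists jb; rewrite ltn_ord.
  have ubP j : (j < c)%N && (1 < G j + G ((2 * c).-1 - j)%N) -> (j <= c)%N.
    by move=> /andP[/ltnW].
  case: (ex_maxnP exP ubP) => kk /andP[kkc big] kkmax.
  (* A single bag would be the declined type-2 bundle. Two of the [c] terms [4/3 * d] then sharpen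
     the bound on [D]. *)
  have c2 : (2 <= c)%N.
    rewrite ltn_neqAle c0 andbT; apply/eqP => c1; move: kkc big S2.
    rewrite -c1 ltnS leqn0 => /eqP -> /=; lra.
  have Dle : D <= 1 / 9 - 8 / 3 * d.
    have : 2 * (4 / 3 * d) <= c%:R * (4 / 3 * d).
      by apply: ler_wpM2r; [lra | rewrite (ler_nat R 2)].
    by lra.
  apply: (mixed_bags_absurd cardK colK G0 Gni cls ltcL S2 S4 Fc j0c Fj0 d0 d1 D0 Dle kkc big _ tot).
  move=> j /andP[kj jc]; rewrite leNgt; apply/negP => jbig.
  by have := kkmax j; rewrite jc jbig => /(_ isT); rewrite leqNgt kj.
rewrite negb_exists => /forallP small.
have Fle j : (j < c)%N -> F j <= 1 + 4 / 3 * d.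
  move=> jc; case: (Fc j jc) => [->|]; last by lra.
  by have := small (Ordinal jc); rewrite -leNgt /=; lra.
(* The open bag stays below [1 + 4/3 * d] by more than [1/4 + d/3]. *)
have : \sum_(0 <= j < c) F j <= \sum_(0 <= j < c) ((1 + 4 / 3 * d) - (j == j0)%:R * (1/4 + d / 3)).
  rewrite !big_nat; apply: ler_sum => j /andP[_ jc].
  have := Fle j jc; case: eqP => [->|_] /=; last by rewrite mul0r subr0.
  by rewrite mul1r; lra.
rewrite sumrB sumr_const_nat subn0 -mulr_suml -natr_sum.
have -> : (\sum_(0 <= j < c) (j == j0) = 1)%N.
  rewrite (big_rem j0) ?mem_index_iota //= eqxx big1_seq ?addn0 // => i /=.
  by rewrite (mem_rem_uniq _ (iota_uniq _ _)) inE => /andP[/negbTE ->].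
rewrite mul1r -[_ *+ c]mulr_natl => h.
by move: h tot Dc; rewrite mulrDr mulr1; lra.
Qed.

(** * Positions in a set of goods *)

Lemma filter_indexE (T : eqType) (x0 : T) (s : seq T) (P : pred nat) : uniq s ->
  [seq x <- s | P (index x s)] =
  [seq nth x0 s i | i <- [seq i <- iota 0 (size s) | P i]].
Proof.
move=> us; transitivity [seq x <- mkseq (nth x0 s) (size s) | P (index x s)].
  by rewrite mkseq_nth.
rewrite /mkseq filter_map; congr map.
apply: eq_in_filter => i; rewrite mem_iota /= => ilt.
by rewrite index_uniq.
Qed.

Lemma nth_take_drop (T : Type) (x0 : T) (s : seq T) a b j : (a <= b)%N ->
  nth x0 (take a s ++ drop b s) j =
  if (j < a)%N then nth x0 s j else nth x0 s (j + (b - a)).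
Proof.
move=> ab; rewrite nth_cat size_take_min.
case: (ltnP j a) => ja; case: (leqP a (size s)) => sa.
- by rewrite ja nth_take.
- case: ifP => js; first by rewrite nth_take.
  by rewrite nth_drop !nth_default //; lia.
- by rewrite ltnNge ja /= nth_drop; congr nth; lia.
- case: ifP => js; first by lia.
  by rewrite nth_drop !nth_default //; lia.
Qed.

Lemma filter_iota_out a b n : (a <= b)%N ->
  [seq i <- iota 0 n | ~~ (a <= i < b)%N] = take a (iota 0 n) ++ drop b (iota 0 n).
Proof.
move=> ab; rewrite -{1}(cat_take_drop b (iota 0 n)) filter_cat; congr (_ ++ _).
  rewrite -{1}(cat_take_drop a (take b _)) filter_cat take_takel //.
  rewrite [X in X ++ _](_ : _ = take a (iota 0 n)); last first.
    apply/all_filterP/allP => i; rewrite take_iota mem_iota; lia.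
  rewrite -[RHS]cats0; congr (_ ++ _).
  apply/eqP; rewrite -size_eq0 size_filter -leqn0 leqNgt -has_count; apply/hasPn => i.
  by rewrite take_iota drop_iota mem_iota; lia.
by apply/all_filterP/allP => i; rewrite drop_iota mem_iota; lia.
Qed.

Section Positions.
Variable m : nat.
Implicit Types (M S : {set 'I_m}) (g h : 'I_m).

Lemma enum_set_sorted M : sorted (relpre val ltn) (enum M).
Proof.
rewrite {1}/enum_mem -enumT; apply: sorted_filter.
  by move=> x y z; apply: ltn_trans.
by rewrite -sorted_map val_enum_ord iota_ltn_sorted.
Qed.

Lemma index_enum_leq M g h : g \in M -> h \in M ->
  (index g (enum M) <= index h (enum M))%N = (g <= h)%N.
Proof.
have tr : transitive (relpre (val : 'I_m -> nat) ltn) by move=> x y z; apply: ltn_trans.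
have H x y : x \in M -> y \in M -> (index x (enum M) < index y (enum M))%N -> (x < y)%N.
  by move=> xM yM; apply: (sorted_ltn_index tr (enum_set_sorted M)); rewrite mem_enum.
move=> gM hM; case: (ltngtP (index g (enum M)) (index h (enum M))) => [lt|lt|e].
- by rewrite (ltnW (H _ _ gM hM lt)).
- by move: (H _ _ hM gM lt); rewrite ltnNge => /negbTE.
by rewrite -(nth_index g (s := enum M) (x := g)) ?mem_enum // e nth_index ?mem_enum ?leqnn.
Qed.

Lemma enum_setId M (P : pred 'I_m) : enum [set g in M | P g] = [seq g <- enum M | P g].
Proof.
rewrite /enum_mem -filter_predI; apply: eq_filter => h /=.
by rewrite !inE andbC.
Qed.

Lemma card_rank M g : g \in M ->
  #|[set h in M | (h <= g)%N]| = (index g (enum M)).+1.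
Proof.
move=> gM; set s := enum M.
have gi : (index g s < size s)%N by rewrite index_mem mem_enum.
transitivity (size [seq h <- s | (index h s <= index g s)%N]).
  have -> : [seq h <- s | (index h s <= index g s)%N] = [seq h : 'I_m <- s | (h <= g)%N].
    by apply: eq_in_filter => h; rewrite mem_enum => hM; rewrite index_enum_leq.
  by rewrite cardE enum_setId.
rewrite (filter_indexE g (fun i => i <= _)%N) ?enum_uniq // size_map.
by rewrite (filter_iota_leq 0 gi : [seq j <- iota 0 _ | (j <= index g s)%N] = _) size_iota.
Qed.

Lemma smallestE M (J : seq nat) :
  smallest M J = [set g in M | (index g (enum M)).+1 \in J].
Proof.
by apply/setP => g; rewrite !inE; case: (boolP (g \in M)) => //= gM; rewrite card_rank.
Qed.

Lemma smallest_sub M J : smallest M J \subset M.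
Proof. by apply/subsetP => g; rewrite inE => /andP[]. Qed.

Lemma enum_setD_smallest M J :
  enum (M :\: smallest M J) = [seq g <- enum M | (index g (enum M)).+1 \notin J].
Proof.
rewrite -enum_setId; apply: eq_enum => g.
by rewrite smallestE !inE; case: (g \in M); rewrite /= ?andbT ?andbF.
Qed.

Section Values.
Variable R : realFieldType.
Implicit Type y : 'I_m -> R.

(* Positions are counted from 0, and all positions beyond #|M| carry value 0. *)
Definition val_at y M (j : nat) : R := nth 0 [seq y g | g <- enum M] j.

Lemma val_at_index y M g : g \in M -> val_at y M (index g (enum M)) = y g.
Proof.
move=> gM; rewrite /val_at (nth_map g) ?index_mem ?mem_enum //.
by rewrite nth_index ?mem_enum.
Qed.

Lemma val_at_default y M j : (#|M| <= j)%N -> val_at y M j = 0.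
Proof. by move=> Mj; rewrite /val_at nth_default // size_map -cardE. Qed.

Lemma val_atP y M j : (j < #|M|)%N ->
  exists2 g, g \in M /\ index g (enum M) = j & val_at y M j = y g.
Proof.
move=> jM; have [g0 _] : exists g, g \in M.
  by apply/card_gt0P; apply: leq_ltn_trans jM.
rewrite cardE in jM; exists (nth g0 (enum M) j).
  by split; [rewrite -mem_enum mem_nth | rewrite index_uniq // enum_uniq].
by rewrite /val_at (nth_map g0).
Qed.

Lemma val_at_ge0 y M j : (forall g, 0 <= y g) -> 0 <= val_at y M j.
Proof.
move=> y0; case: (ltnP j #|M|) => jM; last by rewrite val_at_default.
by have [g _ ->] := val_atP y jM.
Qed.

Lemma val_at_noninc y M p q : (forall g, 0 <= y g) ->
  (forall g h, g \in M -> h \in M -> (g <= h)%N -> y h <= y g) ->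
  (p <= q)%N -> val_at y M q <= val_at y M p.
Proof.
move=> y0 yM pq; case: (ltnP q #|M|) => qM; last by rewrite val_at_default ?val_at_ge0.
have [g [gM gi] ->] := val_atP y (leq_ltn_trans pq qM).
have [h [hM hi] ->] := val_atP y qM.
by apply: yM => //; rewrite -(index_enum_leq gM hM) gi hi.
Qed.

Lemma sum_val_at y M L : (#|M| <= L)%N ->
  \sum_(g in M) y g = \sum_(0 <= j < L) val_at y M j.
Proof.
move=> ML; rewrite (big_cat_nat (n := #|M|)) //=.
rewrite [X in _ = _ + X]big_nat [X in _ = _ + X]big1 ?addr0; last first.
  by move=> j /andP[Mj _]; rewrite val_at_default.
rewrite -big_enum /= -(big_map y xpredT id) (big_nth 0) size_map -cardE.
by [].
Qed.

Lemma sum_smallest y M (J : seq nat) : uniq J -> all (leq 1) J ->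
  \sum_(g in smallest M J) y g = \sum_(j <- J) val_at y M j.-1.
Proof.
move=> uJ J1; rewrite smallestE.
have sJ := sum_val_at (fun g => if (index g (enum M)).+1 \in J then y g else 0) (leqnn #|M|).
rewrite (eq_bigl (fun g => (g \in M) && ((index g (enum M)).+1 \in J))); last first.
  by move=> g; rewrite inE.
rewrite big_mkcondr sJ /=.
rewrite (eq_big_nat _ _ (F2 := fun j => if j.+1 \in J then val_at y M j else 0)); last first.
  move=> j /andP[_ jM].
  have [g [gM gi] ->] := val_atP (fun g => if (index g (enum M)).+1 \in J then y g else 0) jM.
  by rewrite gi; case: ifP => // _; rewrite -gi val_at_index.
rewrite -big_mkcond /= -(big_filter _ (fun j => j.+1 \in J)).
rewrite -(big_map succn xpredT (fun j => val_at y M j.-1)) /=.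
(* Ranks above [#|M|] select no good, and [val_at] vanishes there. *)
rewrite [RHS](bigID (fun j => (j <= #|M|)%N)) /= [X in _ = _ + X]big1 ?addr0; last first.
  by move=> j; rewrite -ltnNge => Mj; rewrite val_at_default //; case: j Mj.
rewrite -[RHS]big_filter; apply: perm_big; apply: uniq_perm.
- by rewrite map_inj_uniq ?filter_uniq ?iota_uniq //; apply: succn_inj.
- by rewrite filter_uniq.
move=> j; rewrite mem_filter; apply/mapP/andP => [[i]|[jM jJ]].
  by rewrite mem_filter mem_index_iota => /andP[iJ /andP[_ iM]] ->.
have j1 := allP J1 _ jJ; exists j.-1; last by rewrite prednK.
by rewrite mem_filter mem_index_iota prednK // jJ.
Qed.

Lemma val_at_setD_interval y M (J : seq nat) a b j : (a <= b)%N ->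
  (forall i, (i.+1 \in J) = (a <= i < b)%N) ->
  val_at y (M :\: smallest M J) j =
  if (j < a)%N then val_at y M j else val_at y M (j + (b - a)).
Proof.
move=> ab Jab; rewrite /val_at enum_setD_smallest.
rewrite (eq_filter (a2 := fun g => ~~ (a <= index g (enum M) < b)%N)); last first.
  by move=> g; rewrite Jab.
case: (set_0Vmem M) => [->|[g0 _]].
  by rewrite enum_set0 /= !nth_nil; case: ifP.
rewrite (filter_indexE g0 (fun i => ~~ (a <= i < b)%N)) ?enum_uniq //.
rewrite filter_iota_out // map_cat map_take map_drop -/(mkseq _ _) mkseq_nth.
by rewrite map_cat map_take map_drop nth_take_drop.
Qed.

Lemma val_at_setD_first y M j :
  val_at y (M :\: smallest M [:: 1%N]) j = val_at y M j.+1.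
Proof.
rewrite (@val_at_setD_interval _ _ _ 0 1) ?ltn0 ?addn1 // => i.
by rewrite inE eqSS; case: i.
Qed.

Lemma val_at_setD_first_and y M b j : (0 < b)%N ->
  val_at y (M :\: smallest M [:: 1; b.+1]%N) j =
  if (j.+1 < b)%N then val_at y M j.+1 else val_at y M j.+2.
Proof.
move=> b0; rewrite /val_at enum_setD_smallest.
rewrite (eq_filter (a2 := predI (fun g => ~~ (0 <= index g (enum M) < 1)%N)
   (fun g => ~~ (b <= index g (enum M) < b.+1)%N))); last first.
  move=> g /=; rewrite !inE; move: (index _ _) => i; apply/idP/idP; lia.
case: (set_0Vmem M) => [->|[g0 _]].
  by rewrite enum_set0 /= !nth_nil; case: ifP.
rewrite (filter_indexE g0 (fun i => ~~ (0 <= i < 1)%N && ~~ (b <= i < b.+1)%N)) ?enum_uniq //.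
rewrite filter_predI filter_iota_out //.
have -> : [seq i <- take b (iota 0 (size (enum M))) ++ drop b.+1 (iota 0 (size (enum M))) | ~~ (0 <= i < 1)%N] =
   behead (take b (iota 0 (size (enum M))) ++ drop b.+1 (iota 0 (size (enum M)))).
  case: (size (enum M)) => [|n'] /=; first by case: b b0.
  case: b b0 => // b' _ /=.
  apply/all_filterP/allP => i; rewrite mem_cat take_iota drop_iota !mem_iota; lia.
rewrite -!behead_map nth_behead map_cat map_take map_drop -/(mkseq _ _) mkseq_nth.
by rewrite map_cat map_take map_drop nth_take_drop // subSnn addn1.
Qed.
End Values.
End Positions.

(** * The two phases seen by one agent *)

Lemma lex_le_total_min n (P : pred ('I_4 * 'I_n)) p : P p ->
  exists q, P q && [forall r, P r ==> lex_le q r].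
Proof.
(* Since the second component is below [n], this code orders the pairs lexicographically. *)
move=> Pp; pose w (r : 'I_4 * 'I_n) := (r.1 * n + r.2)%N.
case: (arg_minnP w Pp) => q Pq qmin; exists q; rewrite Pq /=.
apply/forallP => r; apply/implyP => Pr; move: (qmin r Pr).
rewrite /w /lex_le -val_eqE /=.
move: (ltn_ord q.2) (ltn_ord r.2).
move: (nat_of_ord q.1) (nat_of_ord r.1) (nat_of_ord q.2) (nat_of_ord r.2).
by move=> b c d e dn en; case: ltngtP => //= [cb|->]; [nia | rewrite leq_add2l].
Qed.

Section Phase1.
Variables (R : realFieldType) (n m : nat).
Variables (v : 'I_n -> {set 'I_m} -> R) (tau : 'I_n -> R) (a : 'I_n).

(* Phase 1 seen by agent [a]: an invariant that survives every reduction given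
   to someone else holds at the end of the phase, unless [a] got a reduction. *)
Lemma phase1_invariant (Inv : {set 'I_n} -> {set 'I_m} -> Prop) :
  Inv [set: 'I_n] [set: 'I_m] ->
  (forall (N : {set 'I_n}) (M : {set 'I_m}) (k : 'I_4) i, a \in N -> i \in N -> i != a -> Inv N M ->
     (forall k' : 'I_4, (k' < k)%N -> v a (reduction_bundle N M k') < tau a) ->
     ((a < i)%N -> v a (reduction_bundle N M k) < tau a) ->
     Inv (N :\ i) (M :\: reduction_bundle N M k)) ->
  (forall N : {set 'I_n}, a \in N -> ~ Inv N set0) ->
  let s := phase1 v tau in
  (a \notin agents1 s /\ tau a <= v a (alloc1 s a)) \/
  [/\ a \in agents1 s, Inv (agents1 s) (goods1 s) &
      forall k, v a (reduction_bundle (agents1 s) (goods1 s) k) < tau a].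
Proof.
move=> Inv0 InvS Invne /=; rewrite /phase1.
set s0 := State1 _ _ _.
pose done s := a \notin agents1 s /\ tau a <= v a (alloc1 s a).
pose stuck s := forall p, ~~ reducible v tau s p.
(* Each iteration ends the loop or removes an agent. While [a] is still present, [n] iterations
   cannot all have removed one. *)
suff H t : done (iter t (step1 v tau) s0) \/
    [/\ a \in agents1 (iter t (step1 v tau) s0),
        Inv (agents1 (iter t (step1 v tau) s0)) (goods1 (iter t (step1 v tau) s0)) &
        stuck (iter t (step1 v tau) s0) \/
        (#|agents1 (iter t (step1 v tau) s0)| + t <= n)%N].
  case: (H n) => [?|[aN ? st]]; [by left | right; split => //].
  case: st => [st k|].
    by have := st (k, a); rewrite /reducible /= aN /= -ltNge.
  move=> le; suff : (0 < #|agents1 (iter n (step1 v tau) s0)|)%N by lia.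
  by apply/card_gt0P; exists a.
elim: t => [|t IH].
  by right; rewrite /= inE addn0 cardsT card_ord leqnn; split; auto.
rewrite iterS; case: IH; move: (iter t _ _) => [N M A] /=.
  case=> /= aN ha; left; rewrite /done /step1; case: ifP => // _.
  case: pickP => [[k i] /andP[/andP[/= iN _] _]|_] //=.
  rewrite !inE negb_and aN orbT; split => //; rewrite ffunE.
  by case: eqP => // ai; rewrite ai iN in aN.
case=> aN inv st; rewrite /step1.
case: ifP => [/orP[/eqP N0|/eqP M0]|/norP[_ Mn0]].
- by rewrite N0 inE in aN.
- by case: (Invne N aN); rewrite -M0.
case: pickP => [[k i] /= /andP[/andP[/= iN ti] /forallP kmin]|none]; last first.
  right; split => //; left => p; apply/negP => red.
  have [q qP] := lex_le_total_min red.
  by have := none q; rewrite qP.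
case: (eqVneq i a) => [ia|ia].
  left; rewrite /done /= !inE ia eqxx; split => //.
  by rewrite ffunE eqxx -ia.
(* The pair [(k, i)] is lexicographically minimal, so [a] declined every earlier bundle. *)
have lt (k' : 'I_4) : (k' < k)%N -> v a (reduction_bundle N M k') < tau a.
  move=> k'k; rewrite ltNge; apply/negP => tk.
  have := kmin (k', a); rewrite /reducible /= aN tk /=.
  by rewrite /lex_le /= -val_eqE /=; lia.
right; rewrite /= !inE eq_sym ia aN; split => //.
  apply: InvS => // ai; rewrite ltNge; apply/negP => tk.
  have := kmin (k, a); rewrite /reducible /= aN tk /=.
  by rewrite /lex_le /= eqxx ltnn /= leqNgt ai.
right; case: st => [st|].
  by have := st (k, i); rewrite /reducible /= iN ti.
by rewrite (cardsD1 i N) iN add1n addSn addnS.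
Qed.
End Phase1.

Lemma sum_indicator (R : realFieldType) (T : finType) (A : {set T}) (x : T) :
  \sum_(y in A) (y == x)%:R = (x \in A)%:R :> R.
Proof.
case: (boolP (x \in A)) => xA.
  by rewrite (bigD1 x) //= eqxx big1 ?addr0 // => y /andP[_ /negbTE ->].
by rewrite big1 // => y yA; case: eqP => // yx; rewrite -yx yA in xA.
Qed.

Section Phase2.
Variables (R : realFieldType) (n m : nat).
Variables (v : 'I_n -> {set 'I_m} -> R) (tau : 'I_n -> R) (a : 'I_n).
Variable rule : choice_rule n m.

Definition base_bag (N : {set 'I_n}) (M : {set 'I_m}) (j : nat) : {set 'I_m} :=
  smallest M [:: j.+1; 2 * #|N| - j]%N.

Definition bag_set (N : {set 'I_n}) : {set 'I_n} := [set j : 'I_n | (j < #|N|)%N].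

Definition off_base (N : {set 'I_n}) (M : {set 'I_m}) : {set 'I_m} :=
  M :\: \bigcup_(j in bag_set N) base_bag N M j.

(* How agent [a] sees the bags once they contain all the goods: a bag that was
   topped up was worth less than [tau a] before its last good arrived, and a
   bag worth [tau a] or more went to somebody who precedes [a]. *)
Record final_bags (N : {set 'I_n}) (M : {set 'I_m}) (B : 'I_n -> {set 'I_m}) :
    Prop := FinalBags {
  final_sum : forall y : 'I_m -> R,
    \sum_(j in bag_set N) \sum_(g in B j) y g = \sum_(g in M) y g;
  final_topped : forall j, j \in bag_set N -> B j = base_bag N M j \/
    exists g (B' : {set 'I_m}), [/\ g \in off_base N M, g \notin B', B j = g |: B' & v a B' < tau a];
  final_count : (#|[set j in bag_set N | (tau a <= v a (B j))%R]| <=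
                 #|[set i in N | (i < a)%N]|)%N;
  final_open : exists2 j, j \in bag_set N & v a (B j) < tau a }.

Lemma smallest_first (G : {set 'I_m}) : G != set0 ->
  exists2 g, g \in G & smallest G [:: 1%N] = [set g].
Proof.
rewrite -card_gt0 => /(val_atP (fun=> 0 : R)) [g [gG gi] _]; exists g => //.
apply/setP => h; rewrite smallestE !inE eqSS; apply/andP/eqP => [[hG /eqP hi]|->].
  by apply/val_inj/eqP; rewrite eqn_leq -!(index_enum_leq (M := G)) // hi gi.
by rewrite gG gi.
Qed.

Lemma card_bag_set N : #|bag_set N| = #|N|.
Proof.
have cN : (#|N| <= n)%N by rewrite -[X in (_ <= X)%N]card_ord max_card.
have inj : injective (widen_ord cN) by move=> i j /(congr1 val) /= /val_inj.
rewrite -[RHS]card_ord -(card_imset _ inj).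
apply: eq_card => j; rewrite inE; apply/idP/imsetP => [jN|[i _ ->] //=].
by exists (Ordinal jN) => //; apply: val_inj.
Qed.

Lemma base_bag_disjoint N M (i j : 'I_n) : i \in bag_set N -> j \in bag_set N ->
  i != j -> [disjoint base_bag N M i & base_bag N M j].
Proof.
rewrite !inE -val_eqE /= => iN jN ij; rewrite -setI_eq0; apply/eqP/setP => g.
rewrite !inE; case: (g \in M) => //=; lia.
Qed.

Lemma sum_base_bags N M (y : 'I_m -> R) :
  \sum_(j in bag_set N) \sum_(g in base_bag N M j) y g + \sum_(g in off_base N M) y g =
  \sum_(g in M) y g.
Proof.
have sub : \bigcup_(j in bag_set N) base_bag N M j \subset M.
  by apply/bigcupsP => j _; apply: smallest_sub.
rewrite [RHS](big_setID (\bigcup_(j in bag_set N) base_bag N M j)) (setIidPr sub).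
congr (_ + _).
transitivity (\sum_j \sum_(g in if j \in bag_set N then base_bag N M j else set0) y g).
  rewrite big_mkcond /=; apply: eq_bigr => j _.
  by case: ifP => // _; rewrite big_set0.
rewrite -partition_disjoint_bigcup; last first.
  move=> i j ij; case: ifP => iN; last by rewrite -setI_eq0 set0I.
  by case: ifP => jN; [apply: base_bag_disjoint | rewrite -setI_eq0 setI0].
by apply: eq_bigl => g; rewrite [in RHS]big_mkcond.
Qed.

Lemma phase2_kept s : a \notin agents1 s -> tau a <= v a (alloc1 s a) ->
  tau a <= v a (alloc2 (phase2 v tau rule s) a).
Proof.
case: s => N M A /= aN ta; rewrite /phase2; set s0 := init2 _.
suff H t : a \notin unsat (iter t (step2 v tau rule) s0) /\
    tau a <= v a (alloc2 (iter t (step2 v tau rule) s0) a) by case: (H (n + m)%N).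
elim: t => [|t]; first by rewrite /= aN.
rewrite iterS; move: (iter t _ _) => [U C B G A'] /= [aU h]; rewrite /step2.
case: ifP => // _; case: pickP => [i /andP[/andP[/= iU _] _]|_] /=.
  rewrite !inE negb_and aU orbT; split => //; rewrite ffunE.
  by case: eqP => // ai; rewrite ai iU in aU.
case: ifP => _ //=; rewrite ffunE inE (negbTE aU); split => //.
Qed.

(** Agent [a] can only be left out when the spare goods run out while nobody accepts an open bag;
    the bags then satisfy [final_bags]. *)
Lemma phase2_satisfies s : a \in agents1 s ->
  (forall B, ~ final_bags (agents1 s) (goods1 s) B) ->
  tau a <= v a (alloc2 (phase2 v tau rule s) a).
Proof.
case: s => N M A /= aN nofinal; rewrite /phase2; set s0 := init2 _.
pose C0 := bag_set N.
(* The last clause charges each assigned bag worth at least [tau a] to an agent before [a] who has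
   left [unsat]. *)
pose inv (s : state2 n m) := [/\
  [/\ a \in unsat s, unsat s \subset N, open_bags s \subset C0 &
      #|open_bags s| = #|unsat s|],
  spare s \subset off_base N M,
  forall y : 'I_m -> R, \sum_(j in C0) \sum_(g in bags s j) y g +
    \sum_(g in spare s) y g = \sum_(g in M) y g,
  forall j, j \in C0 -> bags s j = base_bag N M j \/
    exists g (B' : {set 'I_m}), [/\ g \in off_base N M, g \notin B', bags s j = g |: B' & v a B' < tau a] &
  (#|[set j in C0 :\: open_bags s | (tau a <= v a (bags s j))%R]| +
   #|[set i in unsat s | (i < a)%N]| <= #|[set i in N | (i < a)%N]|)%N].
pose done s := a \notin unsat s /\ tau a <= v a (alloc2 s a).
suff H t : done (iter t (step2 v tau rule) s0) \/
    inv (iter t (step2 v tau rule) s0) /\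
    (#|unsat (iter t (step2 v tau rule) s0)| +
     #|spare (iter t (step2 v tau rule) s0)| + t <= n + m)%N.
  case: (H (n + m)%N) => [[//]|[[[aU _ _ _] _ _ _ _]]].
  move=> le; suff : (0 < #|unsat (iter (n + m) (step2 v tau rule) s0)|)%N by lia.
  by apply/card_gt0P; exists a.
elim: t => [|t IH].
  right; split; last first.
    by rewrite addn0 leq_add // -[X in (_ <= X)%N]card_ord max_card.
  rewrite /s0 /inv /= -/(bag_set N) -/C0; split.
  - rewrite aN !subxx; split => //; rewrite /C0 /bag_set.
    exact: card_bag_set.
  - by rewrite /off_base; apply: setDS; apply/bigcupsP => j jC; apply: (bigcup_max j); rewrite ?ffunE.
  - move=> y; under eq_bigr do rewrite ffunE.
    under [X in _ :\: X]eq_bigr do rewrite ffunE.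
    exact: sum_base_bags.
  - by move=> j _; left; rewrite ffunE.
  rewrite setDv (_ : [set j in set0 | _] = set0) ?cards0 //.
  by apply/setP => j; rewrite !inE.
rewrite iterS; case: IH; move: (iter t _ _) => [U C B G A'] /=.
  case=> /= aU h; left; rewrite /done /step2.
  case: ifP => // _; case: pickP => [i /andP[/andP[/= iU _] _]|_] /=.
    rewrite !inE negb_and aU orbT; split => //; rewrite ffunE.
    by case: eqP => // ai; rewrite ai iU in aU.
  by case: ifP => _ //=; rewrite ffunE inE (negbTE aU).
case=> -[/= [aU UN CC0 cCU] GG0 sumB topB cntB] bound; rewrite /step2.
have U0 : U != set0 by apply/set0Pn; exists a.
rewrite (negbTE U0).
case: pickP => [i /andP[/andP[/= iU ai] /forallP imin]|none].
  set k := choose_bag _ _ _.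
  have := choose_bagP rule (State2 U C B G A') ai; rewrite -/k inE /= => /andP[kC tk].
  case: (eqVneq i a) => [ia|ia].
    left; rewrite /done /= !inE ia eqxx; split => //.
    by rewrite ffunE eqxx -ia.
  right; split; last by move: bound; rewrite (cardsD1 i U) iU add1n !addSn addnS.
  rewrite /inv /=; split => //.
  - split; first by rewrite !inE eq_sym ia.
    + by apply: subset_trans UN; apply: subD1set.
    + by apply: subset_trans CC0; apply: subD1set.
    by move: cCU; rewrite (cardsD1 i U) (cardsD1 k C) iU kC !add1n => -[].
  apply: leq_trans cntB.
  have DE : C0 :\: (C :\ k) = k |: (C0 :\: C).
    apply/setP => j; rewrite in_setU1 !in_setD in_set1 negb_and negbK.
    by case: (eqVneq j k) => [->|] //=; rewrite (subsetP CC0 _ kC).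
  rewrite DE.
  case: (ltnP i a) => ia'.
    rewrite (cardsD1 i [set i in U | _]) inE iU ia' /=.
    have -> : [set i0 in U :\ i | (i0 < a)%N] = [set i0 in U | (i0 < a)%N] :\ i.
      by apply/setP => j; rewrite !inE andbA.
    rewrite addnA leq_add2r addnC.
    apply: leq_trans (_ : #|k |: [set j in C0 :\: C | (tau a <= v a (B j))%R]| <= _)%N.
      apply: subset_leq_card; apply/subsetP => j; rewrite !inE.
      by case: (eqVneq j k).
    by rewrite cardsU1; case: (_ \notin _); rewrite ?add0n ?leqnSn.
  (* An agent after [a] is chosen only if [a] accepts no open bag. *)
  have vk : v a (B k) < tau a.
    rewrite ltNge; apply/negP => tak; have := imin a; rewrite /can_receive /= aU /=.
    rewrite (_ : acceptable _ _ _ _ != set0); last by apply/set0Pn; exists k; rewrite inE /= kC.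
    move=> /= ia''; have : i = a by apply/val_inj/eqP; rewrite /= eqn_leq ia'' ia'.
    by move/eqP; rewrite (negbTE ia).
  rewrite leq_add //; apply: subset_leq_card; apply/subsetP => j; rewrite !inE.
    by case: (eqVneq j k) => [->|] //=; rewrite leNgt vk andbF.
  by move=> /andP[/andP[_ ->]].
have openlt j : j \in C -> v a (B j) < tau a.
  move=> jC; rewrite ltNge; apply/negP => tj.
  have cra : can_receive v tau (State2 U C B G A') a.
    by rewrite /can_receive /= aU /=; apply/set0Pn; exists j; rewrite inE /= jC.
  case: (arg_minnP (fun i : 'I_n => i : nat) cra) => i cri imin.
  have /negP := negbT (none i); rewrite /= cri; apply.
  by apply/forallP => i'; apply/implyP => /imin.
have [j jC] : exists j, j \in C by apply/set0Pn; rewrite -card_gt0 cCU card_gt0.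
case: (eqVneq G set0) => [G0|Gn0] /=.
  case: (nofinal B); split => //.
  - by move=> y; rewrite -sumB G0 big_set0 addr0.
  - apply: leq_trans cntB; apply: leq_trans (leq_addr _ _).
    apply: subset_leq_card; apply/subsetP => i; rewrite in_set => /andP[iC ti].
    rewrite in_set in_setD iC ti !andbT; apply/negP => /openlt.
    by rewrite ltNge ti.
  - by exists j; [apply: (subsetP CC0) | apply: openlt].
have [g gG ->] := smallest_first Gn0.
set b := choose_bag _ _ _.
have bC : b \in C by apply: choose_bagP; apply/set0Pn; exists j.
have bC0 := subsetP CC0 _ bC.
(* At the indicator of [g], [sumB] counts the occurrences of [g], and one of them is already among
   the spare goods. *)
have gB : g \notin B b.
  apply/negP => gb; have := sumB (fun h => (h == g)%:R).
  rewrite !sum_indicator gG (bigD1 b) //= sum_indicator gb => h.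
  have : 0 <= \sum_(i in C0 | i != b) \sum_(h in B i) (h == g)%:R :> R.
    by apply: sumr_ge0 => i _; apply: sumr_ge0 => h' _; rewrite ler0n.
  by move: h; case: (g \in M) => /=; lra.
right; split; last by move: bound; rewrite (cardsD1 g G) gG add1n !addnS addSn.
rewrite /inv /=; split => //.
- by apply: subset_trans GG0; apply: subD1set.
- move=> y; rewrite -(sumB y) (bigD1 b) //= ffunE eqxx setUC big_setU1 //=.
  rewrite [in RHS](bigD1 b) //= [X in _ = _ + X](big_setD1 g gG) /=.
  rewrite (eq_bigr (fun i => \sum_(g in B i) y g)); last first.
    by move=> i /andP[_ /negbTE ib]; rewrite ffunE ib.
  lra.
- move=> i iC; rewrite ffunE; case: (eqVneq i b) => [->|_]; last exact: topB.
  by right; exists g, (B b); split; rewrite ?(subsetP GG0) // 1?setUC //; apply: openlt.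
apply: leq_trans cntB; rewrite leq_add2r; apply: subset_leq_card.
apply/subsetP => i; rewrite !in_set ffunE; case: (eqVneq i b) => [->|//].
by rewrite bC.
Qed.
End Phase2.

(** * Thresholds above 3/4 + 1/(12n) *)

Section Reductions.
Variable R : realFieldType.
Implicit Type f : nat -> R.

(* Values of the goods of S_1, .., S_4, and of the goods left after giving one
   of them away, when [f j] is the value of the (j+1)-st remaining good and [c]
   agents remain. *)
Definition bundle_val c f (k : nat) : R :=
  match k with
  | 0 => f 0%N
  | 1 => f c.-1 + f c
  | 2 => f (2 * c).-2 + f (2 * c).-1 + f (2 * c)%N
  | _ => f 0%N + f (2 * c)%N
  end.

Definition values_left c f (k j : nat) : R :=
  match k with
  | 0 => f j.+1
  | 1 => if (j < c.-1)%N then f j else f j.+2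
  | 2 => if (j < (2 * c).-2)%N then f j else f j.+3
  | _ => if (j.+1 < 2 * c)%N then f j.+1 else f j.+2
  end.

Lemma sum_reduction_bundle n m (y : 'I_m -> R) (N : {set 'I_n}) M (k : 'I_4) :
  (0 < #|N|)%N ->
  \sum_(g in reduction_bundle N M k) y g = bundle_val #|N| (val_at y M) k.
Proof.
rewrite /reduction_bundle; move: #|N| => c c0.
case: k => [[|[|[|[|//]]]] lt] /=; rewrite sum_smallest ?big_cons ?big_nil ?addr0 //.
- by rewrite addn1.
- by rewrite /= inE addn1 eqn_leq ltnn andbF.
- by rewrite /= c0 addn1.
- by rewrite addn1 /= addrA; congr (val_at _ _ _ + _ + _); lia.
- rewrite /= !inE; lia.
- by rewrite /=; lia.
- by rewrite addn1.
- rewrite /= !inE; lia.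
- by rewrite /=; lia.
Qed.

Lemma val_at_reduction n m (y : 'I_m -> R) (N : {set 'I_n}) M (k : 'I_4) j :
  (0 < #|N|)%N ->
  val_at y (M :\: reduction_bundle N M k) j = values_left #|N| (val_at y M) k j.
Proof.
rewrite /reduction_bundle; move: #|N| => c c0.
case: k => [[|[|[|[|//]]]] lt] /=.
- exact: val_at_setD_first.
- rewrite (@val_at_setD_interval _ _ _ _ _ c.-1 c.+1); [|lia|].
    by rewrite (_ : c.+1 - c.-1 = 2)%N ?addn2 //; lia.
  by move=> i; rewrite !inE; lia.
- rewrite (@val_at_setD_interval _ _ _ _ _ (2 * c).-2 (2 * c).+1); [|lia|].
    by rewrite (_ : (2 * c).+1 - (2 * c).-2 = 3)%N ?addn3 //; lia.
  by move=> i; rewrite !inE; lia.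
by rewrite addn1 val_at_setD_first_and //; lia.
Qed.

(* The balance [bal] is what remains after putting aside [tau] for every
   remaining agent and [tau / 2] more for every one with higher priority.  It
   can be spoilt by a type-2 reduction only, right after a type-3 reduction (the
   third clause); it may then be negative (the fourth clause), but the next
   type-2 reduction repairs it.  The first clause describes the situation
   before the first reduction of type 3 or 4, after p and t reductions of types
   1 and 2. *)
Definition balanced n (tau : R) (f0 : nat -> R) c bal f :=
  [\/ 0 <= bal /\ exists p t, [/\ (c + p + t = n)%N,
        forall j, (j < c)%N -> f j = f0 (j + p)%N &
        forall j, (c <= j)%N -> f j = f0 (j + p + 2 * t)%N],
      0 <= bal /\ f c <= tau / 2,
      [/\ 0 <= bal, f c + f c.+1 < tau & (2 <= c)%N -> tau - 3 * f c.+1 <= bal] |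
      [/\ f c - tau / 2 <= bal, tau <= f c.-1 + f c & f c <= tau / 2]].

(** Bundles of types 1, 3 and 4 never exceed [3/2 * tau]: they are worth at most 1, or their goods
    are bounded because [S_1] and [S_2] were declined. For type 2 the clauses of [balanced] supply
    the bounds. *)
Lemma balanced_step n (tau : R) f0 c bal f (k : nat) (high : bool) :
  3 / 4 <= tau -> tau <= 1 -> (2 <= c)%N ->
  (forall t, (t < n)%N ->
     f0 (n - t).-1 + f0 (n + t)%N <= 1 \/ 3 * f0 (n + t)%N <= 1) ->
  (forall j, 0 <= f j) -> (forall j, f j <= 1) ->
  (forall i j, (i <= j)%N -> f j <= f i) ->
  (k < 4)%N -> (forall k', (k' < k)%N -> bundle_val c f k' < tau) ->
  (~~ high -> bundle_val c f k < tau) ->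
  balanced n tau f0 c bal f ->
  balanced n tau f0 c.-1 (bal + tau + high%:R * (tau / 2) - bundle_val c f k)
    (values_left c f k).
Proof.
move=> t1 t2 c2 pig f_ge0 f_le1 fni k4 lt_k low.
have fc : f c <= f c.-1 by apply: fni; nat_lia.
have fc1 : f c.+1 <= f c by apply: fni; nat_lia.
have pc : c.-1.+1 = c by nat_lia.
case: k k4 lt_k low => [|[|[|[|//]]]] _ lt_k low inv.
- move: low; rewrite /bundle_val => low.
  have gain : 0 <= tau + high%:R * (tau / 2) - f 0%N.
    by case: (high) low => /= low; [have := f_le1 0%N; lra | have := low isT; lra].
  have -> : forall z, z + tau + high%:R * (tau / 2) - f 0%N =
     z + (tau + high%:R * (tau / 2) - f 0%N) by move=> z; lra.
  move: (_ - f 0%N) gain => z z0.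
  case: inv => [[b0 [p [t [cpt f1 f2]]]]|[b0 fch]|[b0 yx bx]|[b0 yx fch]].
  + apply: Or41; split; first by lra.
    exists p.+1, t; split; first by nat_lia.
    * by move=> j jc; rewrite /values_left f1 ?addnS //; nat_lia.
    * by move=> j jc; rewrite /values_left f2 ?addnS ?addSn //; nat_lia.
  + by apply: Or42; rewrite /values_left pc; split => //; lra.
  + apply: Or43; rewrite /values_left pc; split => //; first by lra.
    by move=> c3; have := bx ltac:(nat_lia); lra.
  + apply: Or44; rewrite /values_left pc prednK; last by nat_lia.
    by split => //; lra.
- have f0t : f 0%N < tau by apply: (lt_k 0%N).
  have fc1t : f c.-1 < tau by apply: le_lt_trans (fni _ _ (leq0n _)) f0t.
  move: low; rewrite /bundle_val => low.
  have nxt : values_left c f 1 c.-1 = f c.+1 by rewrite /values_left ltnn pc.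
  case: inv => [[b0 [p [t [cpt f1 f2]]]]|[b0 fch]|[b0 yx bx]|[b0 yx fch]].
  + apply: Or41; split; last first.
      exists p, t.+1; split; first by nat_lia.
      * by move=> j jc; rewrite /values_left jc f1 //; nat_lia.
      * move=> j jc; rewrite /values_left ltnNge jc /= f2; last by nat_lia.
        by congr f0; nat_lia.
    (* Either the pair is worth at most 1, or its second good is at most [1/3] and the pair less
       than [tau + 1/3 <= 3/2 * tau]. *)
    have := pig t ltac:(nat_lia).
    have -> : f0 (n - t).-1 = f c.-1 by rewrite f1; [congr f0|]; nat_lia.
    have -> : f0 (n + t)%N = f c by rewrite f2 //; congr f0; nat_lia.
    by case: (high) low => /= low; [case; lra | have := low isT; lra].
  + apply: Or42; rewrite nxt; split; last by lra.
    by case: (high) low => /= low; [lra | have := low isT; lra].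
  + case: (high) low => /= low; last first.
      by apply: Or42; rewrite nxt; have := low isT; split; lra.
    rewrite mul1r; have := bx c2; move=> bx2.
    case: (lerP 0 (bal + tau + tau / 2 - (f c.-1 + f c))) => s.
      by apply: Or42; rewrite nxt; split => //; lra.
    (* By [bx2], a negative balance forces the next type-2 bundle to be worth at least [tau]. *)
    apply: Or44; rewrite nxt.
    have -> : values_left c f 1 c.-1.-1 = f c.-2.
      by rewrite /values_left (_ : c.-1.-1 < c.-1 = true)%N //; nat_lia.
    have : f c.-1 <= f c.-2 by apply: fni; nat_lia.
    by split; lra.
  (* The bundle is worth at least [tau], so its recipient precedes [a]; its first good is below
     [tau], which makes the balance nonnegative again. *)
  + case: (high) low => /= low; last by have := low isT; lra.
    by apply: Or42; rewrite nxt; split; lra.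
- have s2 : f c.-1 + f c < tau by apply: (lt_k 1%N).
  (* In the fourth clause [a] would accept [S_2], so no reduction of type 3 occurs there. *)
  have b0 : 0 <= bal by case: inv => [[]|[]|[]|[? ?]] //; lra.
  have e1 : f (2 * c).-2 <= f c by apply: fni; nat_lia.
  have e2 : f (2 * c).-1 <= f c by apply: fni; nat_lia.
  have e3 : f (2 * c)%N <= f c by apply: fni; nat_lia.
  move: low; rewrite /bundle_val => low.
  apply: Or43; split.
  + by case: (high) low => /= low; [lra | have := low isT; lra].
  + rewrite pc /values_left (_ : c.-1 < (2 * c).-2 = true)%N; last by nat_lia.
    case: ifP => _ //; have : f c.+3 <= f c by apply: fni; nat_lia.
    by lra.
  move=> c3; rewrite pc /values_left (_ : c < (2 * c).-2 = true)%N; last by nat_lia.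
  by case: (high) low => /= low; [lra | have := low isT; lra].
have f0t : f 0%N < tau by apply: (lt_k 0%N).
have s2 : f c.-1 + f c < tau by apply: (lt_k 1%N).
have b0 : 0 <= bal by case: inv => [[]|[]|[]|[? ?]] //; lra.
have e3 : f (2 * c)%N <= f c by apply: fni; nat_lia.
move: low; rewrite /bundle_val => low.
apply: Or42; split.
  by case: (high) low => /= low; [lra | have := low isT; lra].
rewrite /values_left pc (_ : c < 2 * c = true)%N; last by nat_lia.
by lra.
Qed.
End Reductions.

Lemma card_ord_lt m s : (s <= m)%N -> #|[set g : 'I_m | (g < s)%N]| = s.
Proof.
move=> sm; have inj : injective (widen_ord sm) by move=> i j /(congr1 val) /= /val_inj.
rewrite -[RHS]card_ord -(card_imset _ inj).
apply: eq_card => j; rewrite inE; apply/idP/imsetP => [jN|[i _ ->] //=].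
by exists (Ordinal jN) => //; apply: val_inj.
Qed.

Lemma index_enum_setT m (g : 'I_m) : index g (enum [set: 'I_m]) = g.
Proof.
rewrite -[LHS]/(index g (enum (mem [set: 'I_m]))).
have -> : enum [set: 'I_m] = enum 'I_m by apply: eq_enum => h; rewrite !inE.
exact: index_enum_ord.
Qed.

Section Agent.
Variables (R : realFieldType) (n m : nat).
Variables (v : 'I_n -> {set 'I_m} -> R) (tau : 'I_n -> R) (a : 'I_n).
Hypotheses (v_add : additive_valuation (v a)).
Hypotheses (v_ord : forall g h : 'I_m, (g <= h)%N -> v a [set h] <= v a [set g]).
Variable cls : 'I_m -> 'I_n.
Hypothesis cls1 : forall l, \sum_(g | cls g == l) v a [set g] = 1.

Let y (g : 'I_m) := v a [set g].

Lemma good_ge0 g : 0 <= y g. Proof. by case: v_add => h _; apply: h. Qed.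
Lemma bundleE S : v a S = \sum_(g in S) y g. Proof. by case: v_add => _ h; apply: h. Qed.

Lemma class_subset (A : pred 'I_m) l : (forall g, A g -> cls g = l) ->
  \sum_(g | A g) y g <= 1.
Proof.
move=> Al; rewrite -(cls1 l) [X in _ <= X](bigID A) /=.
rewrite [X in _ <= X + _](eq_bigl A) => [|g].
  by rewrite lerDl sumr_ge0 // => g _; apply: good_ge0.
by case Ag: (A g); rewrite ?andbF // (Al _ Ag) eqxx.
Qed.

Lemma good_le1 g : y g <= 1.
Proof.
have := @class_subset (pred1 g) (cls g); rewrite big_pred1_eq; apply.
by move=> h /eqP ->.
Qed.

Lemma pair_le1 g h : h != g -> cls h = cls g -> y g + y h <= 1.
Proof.
move=> hg chg; have := @class_subset (pred2 g h) (cls g).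
rewrite (bigD1 g) /= ?eqxx // (bigD1 h) /= ?eqxx ?orbT //=.
move=> le1; apply: le_trans (le1 _); last by move=> i /orP[] /eqP ->.
by rewrite addrA lerDl sumr_ge0 // => i _; apply: good_ge0.
Qed.

Lemma total_value : v a [set: 'I_m] = n%:R.
Proof.
rewrite bundleE (eq_bigl xpredT) => [|g]; last by rewrite inE.
rewrite (partition_big cls xpredT) //=.
under eq_bigr do rewrite cls1.
by rewrite sumr_const card_ord.
Qed.

Let f0 := val_at y [set: 'I_m].

Lemma val_at_setT (g : 'I_m) : f0 g = y g.
Proof. by rewrite -{1}(index_enum_setT g) /f0 val_at_index ?inE. Qed.

(* If the top n - t goods shared no class with one of the next 2t + 1, these
   2t + 1 would lie in t classes, three of them in the same one. *)
Lemma nested_pair_bound t : (t < n)%N ->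
  f0 (n - t).-1 + f0 (n + t)%N <= 1 \/ 3 * f0 (n + t)%N <= 1.
Proof.
move=> tn; case: (lerP (f0 (n - t).-1 + f0 (n + t)%N) 1) => [|yz]; first by left.
right; rewrite leNgt; apply/negP => z3.
have ms : (n + t < m)%N.
  rewrite ltnNge; apply/negP => le; move: z3.
  by rewrite /f0 val_at_default ?cardsT ?card_ord // mulr0 ltr10.
have f0le i j : (i <= j)%N -> f0 j <= f0 i.
  by apply: val_at_noninc => [g|g h _ _]; [exact: good_ge0 | exact: v_ord].
pose top := [set g : 'I_m | (g < n - t)%N].
pose Z := [set g : 'I_m | (g < (n + t).+1)%N].
have Zge g : g \in Z -> f0 (n + t)%N <= y g.
  by rewrite inE ltnS -val_at_setT => /f0le.
have tge g : g \in top -> f0 (n - t).-1 <= y g.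
  by rewrite inE -val_at_setT => gt; apply: f0le; lia.
have tZ : top \subset Z by apply/subsetP => g; rewrite !inE; lia.
have z0 : 0 <= f0 (n + t)%N by apply: val_at_ge0; apply: good_ge0.
(* A top good has weight 2. Every class then carries weight at most 2, while the total is
   [(n + t + 1) + (n - t) = 2n + 1]. *)
have bound l : (\sum_(g in Z | cls g == l) (1 + (g \in top)) <= 2)%N.
  case: (pickP (fun g => (g \in top) && (cls g == l))) => [g /andP[gt gl]|none].
    rewrite (bigD1 g) ?(subsetP tZ g gt) //= gt big1 // => h /andP[/andP[hZ hl] hg].
    exfalso; have := pair_le1 hg; rewrite (eqP gl) (eqP hl) => /(_ erefl).
    by move: (tge g gt) (Zge h hZ) yz; lra.
  rewrite (eq_bigr (fun=> 1%N)) => [|g /andP[_ gl]]; last first.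
    by have := none g; rewrite gl andbT => ->.
  rewrite sum1_card leqNgt; apply/negP => cl.
  have := @class_subset [pred g in Z | cls g == l] l.
  move=> /(_ (fun g h => eqP (andP h).2)); apply/negP; rewrite -ltNge.
  apply: lt_le_trans z3 _.
  apply: (@le_trans _ _ (\sum_(g in Z | cls g == l) f0 (n + t)%N)).
    rewrite sumr_const -[f0 _ *+ _]mulr_natl; apply: ler_wpM2r => //.
    by rewrite ler_nat.
  by apply: ler_sum => g /andP[gZ _]; apply: Zge.
have : (\sum_(g in Z) (1 + (g \in top)) <= \sum_(l < n) 2)%N.
  by rewrite (partition_big cls xpredT) //=; apply: leq_sum => l _; apply: bound.
have -> : (\sum_(g in Z) (1 + (g \in top)) = #|Z| + #|top|)%N.
  rewrite big_split /= sum1_card; congr (_ + _)%N.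
  rewrite -[in RHS](setIidPr tZ) -[RHS]sum1_card.
  rewrite [LHS](eq_bigr (fun g => if g \in top then 1%N else 0%N)) => [|g _]; last by case: (g \in top).
  by rewrite -big_mkcondr; apply: eq_bigl => g; rewrite in_setI.
rewrite sum_nat_const card_ord !card_ord_lt; lia.
Qed.

(** The initial bags pair the positions [j] and [2 * #|N| - 1 - j], counted from 0, and so use up
    the first [2 * #|N|]. *)
Lemma off_base_index (N : {set 'I_n}) (M : {set 'I_m}) g : g \in off_base N M ->
  g \in M /\ (2 * #|N| <= index g (enum M))%N.
Proof.
rewrite !inE => /andP[/bigcupP gb gM]; split => //.
rewrite leqNgt; apply/negP => lt; apply: gb.
have cN : (#|N| <= n)%N by rewrite -[X in (_ <= X)%N]card_ord max_card.
have inbag j (jN : (j < #|N|)%N) : (index g (enum M)).+1 \in [:: j.+1; 2 * #|N| - j]%N ->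
    exists2 i : 'I_n, i \in bag_set N & g \in base_bag N M i.
  by exists (Ordinal (leq_trans jN cN)); rewrite /base_bag ?smallestE inE //= gM.
move: (index g (enum M)) lt inbag => i lt inbag.
case: (ltnP i #|N|) => iN; first by apply: (inbag i) => //; rewrite mem_head.
apply: (inbag ((2 * #|N|).-1 - i)%N); first by lia.
by rewrite !inE; apply/orP; right; apply/eqP; lia.
Qed.

Lemma topped_up_le (N : {set 'I_n}) (M : {set 'I_m}) g : g \in off_base N M ->
  y g <= val_at y M (2 * #|N|)%N.
Proof.
case/off_base_index => gM ge; rewrite -(val_at_index y gM).
by apply: val_at_noninc => [h|h k _ _|//]; [exact: good_ge0 | exact: v_ord].
Qed.

Lemma sum_base_bag (z : 'I_m -> R) (N : {set 'I_n}) M (j : nat) : (j < #|N|)%N ->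
  \sum_(g in base_bag N M j) z g = val_at z M j + val_at z M ((2 * #|N|).-1 - j)%N.
Proof.
move=> jN; rewrite /base_bag sum_smallest.
- by rewrite !big_cons big_nil addr0 /=; congr (_ + val_at _ _ _); lia.
- by rewrite /= inE; lia.
- by rewrite /= andbT subn_gt0 (leq_trans jN) ?leq_pmull.
Qed.

Lemma bundle_valE (N : {set 'I_n}) M (k : 'I_4) : (0 < #|N|)%N ->
  v a (reduction_bundle N M k) = bundle_val #|N| (val_at y M) k.
Proof. by move=> N0; rewrite bundleE sum_reduction_bundle. Qed.

Lemma reduction_bundle_sub (N : {set 'I_n}) (M : {set 'I_m}) k :
  reduction_bundle N M k \subset M.
Proof. exact: smallest_sub. Qed.

Lemma val_at_y_noninc M i j : (i <= j)%N -> val_at y M j <= val_at y M i.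
Proof. by apply: val_at_noninc => [g|g h _ _]; [exact: good_ge0 | exact: v_ord]. Qed.

Lemma val_at_y_ge0 M j : 0 <= val_at y M j.
Proof. exact: val_at_ge0 good_ge0. Qed.

Lemma balanced_ext c bal bal' f f' : bal = bal' -> f =1 f' ->
  balanced n (tau a) f0 c bal f -> balanced n (tau a) f0 c bal' f'.
Proof.
move=> <- ff' [[b0 [p [t [cpt f1 f2]]]]|[b0 fch]|[b0 yx bx]|[b0 yx fch]].
- by apply: Or41; split=> //; exists p, t; split=> // j jc; rewrite -ff'; [exact: f1 | exact: f2].
- by apply: Or42; rewrite -ff'.
- by apply: Or43; rewrite -!ff'.
- by apply: Or44; rewrite -!ff'.
Qed.

Lemma card_setD1_lt (N : {set 'I_n}) i (s : nat) : i \in N ->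
  #|[set j in N | (j < s)%N]| = ((i < s) + #|[set j in N :\ i | (j < s)%N]|)%N.
Proof.
move=> iN; rewrite (cardsD1 i [set j in N | _]) inE iN /=; congr (_ + _)%N.
by apply: eq_card => j; rewrite !inE andbA.
Qed.

(** Counted from 0, [a] is the number of agents preceding it, so the third hypothesis makes the
    initial balance nonnegative. The balance is again nonnegative after phase 1, yet the final bags
    are worth less than the amount put aside. *)
Lemma satisfied_by_priority (rule : choice_rule n m) :
  3 / 4 <= tau a -> tau a <= 1 -> tau a * (n%:R + a%:R / 2) <= n%:R ->
  tau a <= v a (alloc2 (phase2 v tau rule (phase1 v tau)) a).
Proof.
move=> t1 t2 tn.
pose H (N : {set 'I_n}) := [set j in N | (j < a)%N].
pose bal (N : {set 'I_n}) (M : {set 'I_m}) := v a M - tau a * (#|N|%:R + #|H N|%:R / 2).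
pose Inv (N : {set 'I_n}) (M : {set 'I_m}) := balanced n (tau a) f0 #|N| (bal N M) (val_at y M).
have Npos (N : {set 'I_n}) : a \in N -> (0 < #|N|)%N by move=> aN; apply/card_gt0P; exists a.
have Inv0 : Inv setT setT.
  apply: Or41; split.
    rewrite /bal total_value cardsT card_ord (_ : #|H setT| = a).
      by move: tn; lra.
    rewrite -[RHS](card_ord_lt (ltnW (ltn_ord a))).
    by apply: eq_card => j; rewrite !inE.
  exists 0%N, 0%N; rewrite cardsT card_ord !addn0; split=> // j _; first by rewrite addn0.
  by rewrite muln0 !addn0.
have InvS (N : {set 'I_n}) (M : {set 'I_m}) (k : 'I_4) i : a \in N -> i \in N -> i != a -> Inv N M ->
     (forall k' : 'I_4, (k' < k)%N -> v a (reduction_bundle N M k') < tau a) ->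
     ((a < i)%N -> v a (reduction_bundle N M k) < tau a) ->
     Inv (N :\ i) (M :\: reduction_bundle N M k).
  move=> aN iN ia inv lt_k low; have N0 := Npos _ aN.
  have N2 : (2 <= #|N|)%N.
    rewrite (cardsD1 i) iN ltnS; apply/card_gt0P; exists a.
    by rewrite !inE eq_sym ia.
  have st := @balanced_step R n (tau a) f0 #|N| (bal N M) (val_at y M) k (i < a)%N t1 t2 N2
    nested_pair_bound (val_at_y_ge0 M) _ (@val_at_y_noninc M) (ltn_ord k) _ _ inv.
  rewrite /Inv; have -> : #|N :\ i| = #|N|.-1 by rewrite (cardsD1 i N) iN.
  apply: balanced_ext (st _ _ _) => [|j|j|k' k'k|ai].
  - rewrite /bal -bundle_valE // !bundleE.
    rewrite (big_setID (reduction_bundle N M k)) /= (setIidPr (reduction_bundle_sub N M k)).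
    rewrite (cardsD1 i N) iN /H (card_setD1_lt a iN) !natrD.
    by case: (i < a)%N => /=; lra.
  - by rewrite val_at_reduction.
  - case: (ltnP j #|M|) => jM; last by rewrite val_at_default ?ler01.
    by have [g _ ->] := val_atP y jM; apply: good_le1.
  - have := lt_k (Ordinal (ltn_trans k'k (ltn_ord k))); rewrite bundle_valE //=.
    by apply.
  by rewrite -bundle_valE //; apply: low; rewrite ltn_neqAle eq_sym ia leqNgt.
have Invne (N : {set 'I_n}) : a \in N -> ~ Inv N set0.
  move=> aN; have N0 := Npos _ aN.
  have bneg : bal N set0 < 0.
    rewrite /bal bundleE big_set0 sub0r oppr_lt0 mulr_gt0 //; first by lra.
    by rewrite ltr_wpDr ?divr_ge0 ?ler0n ?ltr0n.
  have z j : val_at y set0 j = 0 by rewrite val_at_default ?cards0.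
  by case=> [[]|[]|[]|[]]; rewrite ?z; lra.
case: (phase1_invariant Inv0 InvS Invne) => [[aN ta]|[aN inv stuck]].
  exact: phase2_kept.
apply: phase2_satisfies => // B [sumB topB cntB [j0 j0C Bj0]].
move: (phase1 v tau) aN inv stuck sumB topB cntB j0C => [N M A] /= aN inv stuck sumB topB cntB j0C.
have N0 := Npos _ aN.
have stuck' k : (k < 4)%N -> bundle_val #|N| (val_at y M) k < tau a.
  by move=> k4; have := stuck (Ordinal k4); rewrite bundle_valE.
have s1 := stuck' 0%N isT; have s2 := stuck' 1%N isT.
have fni := @val_at_y_noninc M.
have fN : val_at y M #|N| <= val_at y M #|N|.-1 by apply/fni/leq_pred.
have b0 : 0 <= bal N M by case: inv => [[]|[]|[]|[_ bad _]] //; move: s2 bad; rewrite /=; lra.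
(* The second good of an initial bag has position at least [c], hence value below [tau / 2]; so has
   every good added later. This bounds each bag by [3/2 * tau]. *)
have e2 (j c : nat) : (j < c)%N -> (c <= (2 * c).-1 - j)%N by clear; lia.
have Blt j : j \in bag_set N -> v a (B j) < tau a + (tau a <= v a (B j))%R%:R * (tau a / 2).
  move=> jC; case: (lerP (tau a) (v a (B j))) => [_|lt] /=.
    2: by rewrite mulr0n mul0r addr0.
  rewrite mulr1n mul1r.
  case: (topB j jC) => [->|[g [B' [gG gB' -> B't]]]].
    rewrite inE in jC; rewrite bundleE sum_base_bag //.
    have := fni 0%N j (leq0n _).
    have : val_at y M ((2 * #|N|).-1 - j) <= val_at y M #|N| by apply/fni/e2.
    by move: s1 s2; rewrite /=; lra.
  have := topped_up_le gG.
  have : val_at y M (2 * #|N|)%N <= val_at y M #|N| by apply/fni/leq_pmull.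
  by rewrite bundleE big_setU1 //= -bundleE; move: s2; rewrite /=; lra.
have : v a M < tau a * (#|N|%:R + #|H N|%:R / 2).
  rewrite bundleE -sumB.
  under eq_bigr do rewrite -bundleE.
  apply: (@lt_le_trans _ _ (\sum_(j in bag_set N) (tau a + (tau a <= v a (B j))%R%:R * (tau a / 2)))).
    rewrite (bigD1 j0) //= [X in _ < X](bigD1 j0) //= ltr_leD ?Blt //.
    by apply: ler_sum => j /andP[jC _]; apply/ltW/Blt.
  rewrite big_split /= sumr_const card_bag_set -mulr_suml -natr_sum.
  have -> : (\sum_(j in bag_set N) (tau a <= v a (B j))%R = #|[set j in bag_set N | (tau a <= v a (B j))%R]|)%N.
    rewrite -sum1_card big_mkcond /= [RHS]big_mkcond /=; apply: eq_bigr => j _.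
    by rewrite !in_set; case: (j < _)%N; case: (tau a <= _).
  have : (#|[set j in bag_set N | (tau a <= v a (B j))%R]|%:R : R) <= #|H N|%:R by rewrite ler_nat.
  rewrite -mulr_natl => le; have : 0 <= tau a by lra.
  by move=> t0; have := ler_wpM2r t0 le; lra.
by move: b0; rewrite /bal; lra.
Qed.

End Agent.

(** * The threshold 3/4 + 1/(12n) *)

Lemma card_index_lt m (M : {set 'I_m}) r :
  #|[set g in M | (index g (enum M) < r)%N]| = minn r #|M|.
Proof.
case: (set_0Vmem M) => [->|[g0 _]].
  by rewrite cards0 minn0; apply/eqP; rewrite cards_eq0; apply/eqP/setP => g; rewrite !inE.
rewrite cardE enum_setId (filter_indexE g0 (fun i => i < r)%N) ?enum_uniq // size_map.
rewrite -cardE; case: (leqP r #|M|) => rM.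
  by rewrite (filter_iota_ltn 0 rM : [seq i <- iota 0 _ | (i < r)%N] = _) size_iota.
rewrite (_ : [seq i <- _ | _] = iota 0 #|M|) ?size_iota //.
by apply/all_filterP/allP => i; rewrite mem_iota; lia.
Qed.

Section Packing.
Variables (R : realFieldType) (n m : nat) (y : 'I_m -> R).
Hypothesis y_ord : forall g h : 'I_m, (g <= h)%N -> y h <= y g.
Implicit Types (K : {set 'I_n}) (M S Z : {set 'I_m}).
Implicit Types (col : 'I_m -> 'I_n) (z : 'I_m -> R).

(* The goods of [M], at reduced values [z], fill bundles of value at most 1
   that are indexed by [K]. *)
Definition packing K M col z : Prop :=
  [/\ forall g, col g \in K, forall g, 0 <= z g,
      forall g, z g <= (if g \in M then y g else 0) &
      forall l, l \in K -> \sum_(g | col g == l) z g <= 1].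

(* Swaps with goods of [Z] that are at least as valuable bring [S] into class
   [l]; the values at [S] itself may then exceed [y], but class [l] is deleted. *)
Lemma gather K M S Z col z l d :
  S \subset Z -> Z \subset M -> l \in K ->
  (forall s u, s \in S -> u \in Z :\: S -> y s <= y u) ->
  #|[set g in S | col g != l]| = d ->
  (#|S| <= #|[set g in Z | col g == l]|)%N ->
  (forall g, col g \in K) -> (forall g, 0 <= z g) ->
  (forall g, g \notin M -> z g = 0) ->
  (forall g, g \in M -> ~~ ((g \in S) && (col g == l)) -> z g <= y g) ->
  (forall l, l \in K -> \sum_(g | col g == l) z g <= 1) ->
  exists col' z', [/\ [/\ forall g, col' g \in K, forall g, 0 <= z' g &
     forall g, g \notin M -> z' g = 0],
     (forall g, g \in M -> g \notin S -> z' g <= y g),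
     (forall l, l \in K -> \sum_(g | col' g == l) z' g <= 1),
     \sum_g z' g = \sum_g z g & forall g, g \in S -> col' g = l].
Proof.
move=> SZ ZM lK dom; elim: d col z => [|d IH] col z cd cSZ colK z0 zM zy cls.
  have Sl g : g \in S -> col g = l.
    move=> gS; apply/eqP; apply: contraT => gl.
    by move/eqP: cd; rewrite cards_eq0 => /eqP/setP/(_ g); rewrite !inE gS gl.
  exists col, z; split => // g gM gS; apply: zy => //.
  by rewrite (negbTE gS).
have [s] : exists s, s \in [set g in S | col g != l] by apply/card_gt0P; rewrite cd.
rewrite inE => /andP[sS sl].
have [u uZ] : exists u, u \in [set g in Z | col g == l] :\: S.
  apply/set0Pn; apply/negP; rewrite setD_eq0 => sub.
  have : [set g in Z | col g == l] \subset S :\ s.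
    apply/subsetP => g gZ; rewrite in_setD1 (subsetP sub _ gZ) andbT.
    by apply: contraTneq gZ => ->; rewrite inE (negbTE sl) andbF.
  by move/subset_leq_card; move: cSZ; rewrite (cardsD1 s S) sS; lia.
move: uZ; rewrite !inE => /andP[uS /andP[uZ /eqP ul]].
have su : s != u by apply: contraNneq uS => <-.
have sZ := subsetP SZ _ sS.
pose p := tperm s u.
have pZ g : (p g \in Z) = (g \in Z).
  by rewrite /p; case: tpermP => [->|->|//]; rewrite sZ uZ.
have pM g : (p g \in M) = (g \in M).
  by rewrite /p; case: tpermP => [->|->|//]; rewrite !(subsetP ZM).
have [|||||||col' [z' [[h1 h2 h3] h4 h5 h6 h7]]] := IH (col \o p) (z \o p).
- have : [set g in S | (col \o p) g != l] = [set g in S | col g != l] :\ s.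
    apply/setP => g; rewrite !inE /= /p; case: tpermP => [->|->|/eqP gs gu].
    + by rewrite ul !eqxx /= andbF.
    + by rewrite (negbTE uS) andbF.
    + by rewrite gs.
  by move=> ->; move: cd; rewrite (cardsD1 s) inE sS sl => -[].
- suff -> : #|[set g in Z | (col \o p) g == l]| = #|[set g in Z | col g == l]| by [].
  rewrite -(card_imset _ (@perm_inj _ p)); apply: eq_card => g; rewrite inE.
  apply/imsetP/andP => [[h]|[gZ gl]]; first by rewrite inE /= => /andP[hZ hl] ->; rewrite pZ.
  by exists (p g); rewrite ?inE /= ?pZ /p ?tpermK ?gZ.
- by move=> g; apply: colK.
- by move=> g; apply: z0.
- by move=> g gM; apply: zM; rewrite pM.
- move=> g gM /=; rewrite /p; case: tpermP => [->|->|/eqP gs /eqP gu].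
  + by rewrite sS ul eqxx.
  + move=> _; apply: le_trans (dom s u sS _); last by rewrite inE uS.
    by apply: zy; [apply: (subsetP ZM) | rewrite (negbTE sl) andbF].
  + exact: zy.
- move=> l' l'K /=; rewrite [X in X <= _](reindex_inj (@perm_inj _ p)) /=.
  by rewrite (eq_big (fun g => col g == l') z) ?cls // => g; rewrite ?tpermK // => _; rewrite tpermK.
exists col', z'; split => //; rewrite h6 [RHS](reindex_inj (@perm_inj _ p)).
by [].
Qed.

Lemma packing_remove_class K M S Z col z l :
  (2 <= #|K|)%N -> packing K M col z -> S \subset Z -> Z \subset M ->
  (forall s u, s \in S -> u \in Z :\: S -> y s <= y u) ->
  l \in K -> (#|S| <= #|[set g in Z | col g == l]|)%N ->
  exists K' col' z', [/\ #|K'| = #|K|.-1, packing K' (M :\: S) col' z' &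
    \sum_g z g - 1 <= \sum_g z' g].
Proof.
move=> K2 [colK z0 zy cls] SZ ZM dom lK cl.
have [||col' [z' [[h1 h2 h3] h4 h5 h6 h7]]] := gather SZ ZM lK dom erefl cl colK z0 _ _ cls.
- by move=> g gM; apply/eqP; rewrite eq_le z0 andbT; have := zy g; rewrite (negbTE gM).
- by move=> g gM _; have := zy g; rewrite gM.
have [l' l'K] : exists l', l' \in K :\ l.
  by apply/card_gt0P; move: K2; rewrite (cardsD1 l) lK; lia.
(* Class [l] disappears: its goods get value 0 and move to another class. *)
exists (K :\ l), (fun g => if col' g == l then l' else col' g),
  (fun g => if col' g == l then 0 else z' g); split.
- by rewrite (cardsD1 l K) lK.
- split=> [g|g|g|k].
  + by case: eqP => // /eqP gl; rewrite !inE gl h1.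
  + by case: eqP.
  + rewrite inE; case: (boolP (g \in M)) => gM; last by rewrite andbF h3 // if_same.
    case: (boolP (g \in S)) => gS /=; first by rewrite h7 // eqxx.
    case: eqP => _; last exact: h4.
    by apply: le_trans (h4 g gM gS); apply: h2.
  rewrite !inE => /andP[kl kK]; apply: le_trans (h5 k kK).
  rewrite le_eqVlt big_mkcond [X in _ == X]big_mkcond /=; apply/orP; left; apply/eqP.
  apply: eq_bigr => g _; case: (eqVneq (col' g) l) => [->|//].
  by rewrite if_same eq_sym (negbTE kl).
rewrite -h6 (bigID (fun g => col' g == l)) /= [X in _ <= X](bigID (fun g => col' g == l)) /=.
rewrite [X in _ <= X + _]big1 => [|g ->//]; rewrite add0r.
rewrite [X in _ <= X](eq_bigr z') => [|g /negbTE -> //].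
by have := h5 l lK; lra.
Qed.

(** Were every class to meet [Z] in at most [#|S| - 1] goods, [Z] would have at most
    [#|K| * (#|S| - 1)] of them. *)
Lemma packing_remove K M S Z col z :
  (2 <= #|K|)%N -> packing K M col z -> S \subset Z -> Z \subset M ->
  (forall s u, s \in S -> u \in Z :\: S -> y s <= y u) ->
  (S == set0) || (#|K| * #|S|.-1 < #|Z|)%N ->
  exists K' col' z', [/\ #|K'| = #|K|.-1, packing K' (M :\: S) col' z' &
    \sum_g z g - 1 <= \sum_g z' g].
Proof.
move=> K2 pk SZ ZM dom big; have [colK _ _ _] := pk.
suff [l lK cl] : exists2 l, l \in K & (#|S| <= #|[set g in Z | col g == l]|)%N.
  exact: (packing_remove_class K2 pk SZ ZM dom lK cl).
case/orP: big => [/eqP ->|big].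
  have [l lK] : exists l, l \in K by apply/card_gt0P; lia.
  by exists l; rewrite ?cards0.
case: (pickP (fun l => (l \in K) && (#|S| <= #|[set g in Z | col g == l]|)%N)).
  by move=> l /andP[]; exists l.
move=> none; exfalso; move: big; rewrite ltnNge => /negP; apply.
rewrite -sum_nat_const -sum1_card (partition_big col (mem K)) //=.
apply: leq_sum => l lK; have := none l; rewrite lK /= => /negbT; rewrite -ltnNge.
rewrite sum1_card (_ : #|_| = #|[set g in Z | col g == l]|); last first.
  by apply: eq_card => g; rewrite inE.
by case: #|S|.
Qed.

(** [S] is the interval of ranks from [a + 1] to [r], and [Z] consists of all ranks up to [r]. The
    number [mu] stands for [#|M|]; the minima cover the case of fewer than [r] goods. *)
Lemma packing_remove_ranks K M col z (J : seq nat) a r :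
  (2 <= #|K|)%N -> packing K M col z ->
  (forall i, (i.+1 \in J) = (a <= i < r)%N) -> (a <= r)%N ->
  (forall mu, minn r mu = minn a mu \/
     (#|K| * (minn r mu - minn a mu).-1 < minn r mu)%N) ->
  exists K' col' z', [/\ #|K'| = #|K|.-1, packing K' (M :\: smallest M J) col' z' &
    \sum_g z g - 1 <= \sum_g z' g].
Proof.
move=> K2 pk JE ar big.
pose Z s := [set g in M | (index g (enum M) < s)%N].
have SE : smallest M J = Z r :\: Z a.
  apply/setP => g; rewrite smallestE !inE JE.
  by case: (g \in M); rewrite //= -leqNgt andbC.
have ZZ : Z a \subset Z r.
  by apply/subsetP => g; rewrite !inE => /andP[-> /leq_trans]; apply.
have cS : #|smallest M J| = (minn r #|M| - minn a #|M|)%N.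
  by rewrite SE cardsD (setIidPr ZZ) !card_index_lt.
apply: (packing_remove (Z := Z r) K2 pk).
- by rewrite SE subsetDl.
- by apply/subsetP => g; rewrite inE => /andP[].
- move=> s u; rewrite SE !inE => /andP[sa /andP[sM sr]] /andP[ua /andP[uM ur]].
  apply: y_ord; rewrite -(index_enum_leq uM sM).
  by move: sa ua; rewrite sM uM ur /= andbT negbK -leqNgt => h1 /ltnW h2; apply: leq_trans h1.
case: (big #|M|) => [e|lt]; last by rewrite cS card_index_lt lt orbT.
by rewrite -cards_eq0 cS e subnn.
Qed.

(* A type-4 reduction whose two goods lie in different bundles: what remains of
   the two bundles is merged and scaled down to 1 if necessary. *)
Lemma packing_merge K M col z s1 s2 (t : R) :
  packing K M col z -> s1 \in M -> s2 \in M -> col s1 != col s2 ->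
  y s1 + y s2 <= 1 + t -> 0 <= t ->
  exists K' col' z', [/\ #|K'| = #|K|.-1, packing K' (M :\: [set s1; s2]) col' z' &
    \sum_g z g - (1 + t) <= \sum_g z' g].
Proof.
move=> [colK z0 zy cls] s1M s2M l12 yt t0.
set l1 := col s1 in l12 *; set l2 := col s2 in l12 *.
pose T := [pred g | (col g == l1) || (col g == l2)].
pose S := [set s1; s2].
have ST g : g \in S -> T g by rewrite !inE => /orP[] /eqP ->; rewrite eqxx ?orbT.
pose w g := if g \in S then 0 else z g.
have w0 g : 0 <= w g by rewrite /w; case: ifP.
have wz g : w g <= z g by rewrite /w; case: ifP.
pose sg := \sum_(g | T g) w g.
have sg0 : 0 <= sg by apply: sumr_ge0.
pose rho := if 1 < sg then sg^-1 else 1.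
have rho01 : 0 <= rho <= 1.
  rewrite /rho; case: ifP => [sg1|_]; last by rewrite ler01 lexx.
  by rewrite invr_ge0 sg0 invf_le1 ?ltW // (lt_trans ltr01).
case/andP: rho01 => r0 r1.
have sT : \sum_(g | T g) z g = \sum_(g | col g == l1) z g + \sum_(g | col g == l2) z g.
  rewrite (bigID (fun g => col g == l1)) /=; congr (_ + _); apply: eq_bigl => g.
    by case: (col g == l1); rewrite ?andbF.
  by case: eqP => [->|]; rewrite ?andbT ?(negbTE l12).
have s12 : s1 != s2 by apply: contraNneq l12; rewrite /l1 /l2 => ->.
have sw : \sum_(g | T g) z g <= sg + (1 + t).
  rewrite (bigD1 s1) /= ?eqxx // (bigD1 s2) /= ?eqxx ?orbT 1?eq_sym //.
  have : \sum_(g | T g && (g != s1) && (g != s2)) z g <= sg.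
    rewrite /sg [X in _ <= X](bigID (mem S)) /= [X in _ <= X + _]big1 ?add0r => [|g /andP[_ gS]].
      rewrite le_eqVlt; apply/orP; left; apply/eqP; apply: eq_big => g.
        by rewrite !inE negb_or andbA.
      by rewrite -andbA -negb_or => /andP[_ gS]; rewrite /w !inE (negbTE gS).
    by rewrite /w gS.
  by have := zy s1; have := zy s2; rewrite s1M s2M; move: yt; lra.
exists (K :\ l2), (fun g => if col g == l2 then l1 else col g),
  (fun g => if T g then rho * w g else w g); split.
- by rewrite (cardsD1 l2 K) colK.
- split=> [g|g|g|k].
  + by rewrite in_setD1; case: (eqVneq (col g) l2) => [_|gl]; rewrite ?l12 ?gl ?colK.
  + by case: ifP => _ //; apply: mulr_ge0.
  + have le : w g <= (if g \in M :\: S then y g else 0).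
      by rewrite /w in_setD; case: (boolP (g \in S)) => gS /=; [exact: lexx | exact: zy].
    case: ifP => _ //; apply: le_trans le.
    by rewrite ler_piMl.
  rewrite !inE => /andP[kl2 kK]; case: (eqVneq k l1) => [->|kl1].
    rewrite (eq_bigl T) => [|g]; last by rewrite /=; case: (eqVneq (col g) l2); rewrite ?eqxx ?orbT ?orbF.
    rewrite (eq_bigr (fun g => rho * w g)) => [|g ->//].
    rewrite -mulr_sumr -/sg /rho; case: ltP => [sg1|]; last by rewrite mul1r.
    by rewrite mulVf ?lexx // gt_eqF // (lt_trans ltr01).
  apply: le_trans (cls k kK); rewrite (eq_bigl (fun g => col g == k)) => [|g].
    apply: ler_sum => g /eqP gk; rewrite /= gk (negbTE kl1) (negbTE kl2) /=.
    exact: wz.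
  by case: (eqVneq (col g) l2) => [->|//]; rewrite eq_sym (negbTE kl1) eq_sym (negbTE kl2).
rewrite (bigID T) [X in _ <= X](bigID T) /=.
rewrite [X in _ <= X + _](eq_bigr (fun g => rho * w g)) => [|g -> //].
rewrite [X in _ <= _ + X](eq_bigr z) => [|g gT]; last first.
  rewrite (negbTE gT) /w; case: ifP => // /ST; by rewrite /= (negbTE gT).
rewrite -mulr_sumr -/sg.
(* If scaling takes place, the merged bundle keeps value 1 out of at most 2; otherwise only [s1] and
   [s2] are lost. *)
have : \sum_(g | T g) z g - (1 + t) <= rho * sg.
  rewrite /rho; case: ltP => [sg1|sg1]; last by rewrite mul1r; lra.
  rewrite mulVf ?gt_eqF ?(lt_trans ltr01) // sT.
  by have := cls l1 (colK s1); have := cls l2 (colK s2); lra.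
by rewrite /T /=; lra.
Qed.
End Packing.

Section SortedPacking.
Variables (R : realFieldType) (m : nat) (y z : 'I_m -> R) (M : {set 'I_m}).
Hypothesis y_ord : forall g h : 'I_m, (g <= h)%N -> y h <= y g.
Hypothesis zy : forall g, z g <= (if g \in M then y g else 0).

(* Among the admissible permutations, one that puts as much value as possible
   early is sorted. *)
Lemma sorting_perm : exists p : {perm 'I_m},
  (forall g, z (p g) <= (if g \in M then y g else 0)) /\
  (forall g h, g \in M -> h \in M -> (g <= h)%N -> z (p h) <= z (p g)).
Proof.
pose ok (p : {perm 'I_m}) := [forall g, z (p g) <= (if g \in M then y g else 0)].
pose w (p : {perm 'I_m}) := \sum_g z (p g) * (m - g)%:R.
have ok1 : ok 1%g by apply/forallP => g; rewrite perm1.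
case: (arg_maxP w ok1) => p okp pmax; exists p.
split=> [g|g h gM hM gh]; first by apply: (forallP okp).
rewrite leNgt; apply/negP => lt.
have gneh : g != h by apply: contraTneq lt => ->; rewrite ltxx.
have gh' : (g < h)%N by rewrite ltn_neqAle gh andbT.
(* The swap is admissible, since [z (p g) < z (p h) <= y h <= y g], and it increases [w]. *)
pose q := (tperm g h * p)%g.
have qE x : q x = p (tperm g h x) by rewrite permM.
have okh : z (p h) <= y h by have := forallP okp h; rewrite hM.
have okq : ok q.
  apply/forallP => x; rewrite qE; case: tpermP => [->|->|_ _].
  - by rewrite gM (le_trans okh) // y_ord.
  - by rewrite hM (le_trans _ okh) // ltW.
  exact: (forallP okp).
have := pmax q okq; apply/negP; rewrite -ltNge /w.
rewrite (bigD1 g) // (bigD1 h) 1?eq_sym //= [X in _ < X](bigD1 g) // [in X in _ < X](bigD1 h) 1?eq_sym //=.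
rewrite !qE tpermL tpermR.
rewrite [X in _ < _ + (_ + X)](eq_bigr (fun i => z (p i) * (m - i)%:R)) => [|i /andP[ig ih]]; last first.
  by rewrite qE tpermD // eq_sym.
rewrite !addrA ltrD2r.
have := ltr_pM2r (_ : 0 < (m - g)%:R - (m - h)%:R :> R) (z (p g)) (z (p h)).
rewrite lt => h1; have : 0 < (m - g)%:R - (m - h)%:R :> R.
  by rewrite subr_gt0 ltr_nat ltn_sub2l // (ltn_trans gh').
by move/h1; lra.
Qed.
End SortedPacking.

Lemma le_val_at (R : realFieldType) m (y y' : 'I_m -> R) (M : {set 'I_m}) j :
  (forall g, g \in M -> y g <= y' g) -> val_at y M j <= val_at y' M j.
Proof.
move=> le; case: (ltnP j #|M|) => jM; last by rewrite !val_at_default.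
have [g [gM <-] ->] := val_atP y jM; rewrite val_at_index //; exact: le.
Qed.

Section Agent.
Variables (R : realFieldType) (n m : nat).
Variables (v : 'I_n -> {set 'I_m} -> R) (tau : 'I_n -> R) (a : 'I_n).
Hypotheses (v_add : additive_valuation (v a)).
Hypotheses (v_ord : forall g h : 'I_m, (g <= h)%N -> v a [set h] <= v a [set g]).
Variable cls : 'I_m -> 'I_n.
Hypothesis cls1 : forall l, \sum_(g | cls g == l) v a [set g] = 1.
Let y (g : 'I_m) := v a [set g].

Let y_ge0 g : 0 <= y g. Proof. exact: good_ge0. Qed.
Let vE S : v a S = \sum_(g in S) y g. Proof. exact: bundleE. Qed.

(** Each of the [n - #|N|] reductions made so far may cost one bundle of value 1 and [t] besides. *)
Definition packed (t : R) (N : {set 'I_n}) (M : {set 'I_m}) : Prop :=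
  exists (K : {set 'I_n}) col z, [/\ #|K| = #|N|, packing y K M col z &
    #|N|%:R - (n%:R - #|N|%:R) * t <= \sum_g z g].

(** With [c = #|N|], the last rank in a bundle of type 1, 2 or 3 is 1, [c + 1] or [2c + 1]. By
    pigeonhole some class has at least 1, 2 or 3 goods up to this rank. *)
Lemma packed_step t (N : {set 'I_n}) (M : {set 'I_m}) (k : 'I_4) i :
  0 <= t -> tau a * 4 / 3 <= 1 + t -> a \in N -> i \in N -> i != a ->
  packed t N M ->
  (forall k' : 'I_4, (k' < k)%N -> v a (reduction_bundle N M k') < tau a) ->
  packed t (N :\ i) (M :\: reduction_bundle N M k).
Proof.
move=> t0 tt aN iN ia [K [col [z [cK pk tot]]]] lt_k.
have N2 : (2 <= #|N|)%N.
  rewrite (cardsD1 i) iN ltnS; apply/card_gt0P; exists a.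
  by rewrite !inE eq_sym ia.
have N0 : (0 < #|N|)%N by apply: ltn_trans N2.
have K2 : (2 <= #|K|)%N by rewrite cK.
suff [K' [col' [z' [cK' pk' tot']]]] : exists (K' : {set 'I_n}) col' z',
    [/\ #|K'| = #|K|.-1, packing y K' (M :\: reduction_bundle N M k) col' z' &
     \sum_g z g - (1 + t) <= \sum_g z' g].
  exists K', col', z'; split => //.
    by rewrite cK' cK (cardsD1 i N) iN.
  by apply: le_trans tot'; move: tot; rewrite (cardsD1 i N) iN add1n -natr1; lra.
have weaken M' : (exists (K' : {set 'I_n}) col' z', [/\ #|K'| = #|K|.-1, packing y K' M' col' z' &
    \sum_g z g - 1 <= \sum_g z' g]) -> exists (K' : {set 'I_n}) col' z',
    [/\ #|K'| = #|K|.-1, packing y K' M' col' z' & \sum_g z g - (1 + t) <= \sum_g z' g].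
  case=> K' [col' [z' [h1 h2 h3]]]; exists K', col', z'; split => //.
  by apply: le_trans h3; lra.
have lt' k' : (k' < k)%N -> bundle_val #|N| (val_at y M) k' < tau a.
  move=> k'k; have := lt_k (Ordinal (ltn_trans k'k (ltn_ord k))).
  by rewrite (bundle_valE v_add) //=; apply.
have first_removed : exists (K' : {set 'I_n}) col' z', [/\ #|K'| = #|K|.-1,
    packing y K' (M :\: smallest M [:: 1%N]) col' z' & \sum_g z g - 1 <= \sum_g z' g].
  apply: (@packing_remove_ranks _ _ _ _ v_ord _ _ _ _ [:: 1%N] 0 1 K2 pk) => // [i'|mu].
    by rewrite inE; case: i'.
  by clear; case: mu => [|mu]; [left | right]; lia.
move: lt'; rewrite /reduction_bundle; case: k {lt_k} => [[|[|[|[|//]]]] lt] /= lt'.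
- exact: weaken.
- apply: weaken; apply: (@packing_remove_ranks _ _ _ _ v_ord _ _ _ _ _ #|N|.-1 #|N|.+1 K2 pk).
  + by move=> j; rewrite !inE; move: #|N| N0 => c c0; clear -c0; lia.
  + by apply: leq_trans (leq_pred _) _.
  + rewrite cK; move: #|N| N0 => c c0 mu; clear -c0.
    case: (boolP (mu <= c.-1)%N) => h; [left; lia | right].
    case: (boolP (c.+1 <= mu)%N) => h1.
      have -> : (minn c.+1 mu - minn c.-1 mu).-1 = 1%N by lia.
      by lia.
    have -> : (minn c.+1 mu - minn c.-1 mu).-1 = 0%N by lia.
    by lia.
- apply: weaken; apply: (@packing_remove_ranks _ _ _ _ v_ord _ _ _ _ _ (2 * #|N|).-2 (2 * #|N|).+1 K2 pk).
  + by move=> j; rewrite !inE; move: #|N| N0 => c c0; clear -c0; lia.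
  + by move: #|N| => c; clear; lia.
  + rewrite cK; move: #|N| N0 => c c0 mu; clear -c0.
    case: (boolP (mu <= (2 * c).-2)%N) => h; [left; lia | right].
    case: (boolP ((2 * c).+1 <= mu)%N) => h1.
      have -> : (minn (2 * c).+1 mu - minn (2 * c).-2 mu).-1 = 2%N by lia.
      by lia.
    case: (boolP (2 * c <= mu)%N) => h2.
      have -> : (minn (2 * c).+1 mu - minn (2 * c).-2 mu).-1 = 1%N by lia.
      by lia.
    have -> : (minn (2 * c).+1 mu - minn (2 * c).-2 mu).-1 = 0%N by lia.
    by lia.
(* With at most [2 * #|N|] goods left, [S_4] is the first good alone. *)
case: (leqP #|M| (2 * #|N|)) => Mle.
  have -> : smallest M [:: 1; 2 * #|N| + 1]%N = smallest M [:: 1%N].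
    apply/setP => g; rewrite !smallestE !inE; case: (boolP (g \in M)) => //= gM.
    have : (index g (enum M) < #|M|)%N by rewrite cardE index_mem mem_enum.
    by rewrite addn1 !eqSS => lti; rewrite [_ == (2 * _)%N]ltn_eqF ?orbF // (leq_trans lti).
  exact: weaken.
have [s1 [s1M i1] e1] := val_atP y (leq_ltn_trans (leq0n _) Mle).
have [s2 [s2M i2] e2] := val_atP y Mle.
have -> : smallest M [:: 1; 2 * #|N| + 1]%N = [set s1; s2].
  apply/setP => g; rewrite smallestE !inE addn1 !eqSS.
  have idx s : s \in M -> g \in M -> (index g (enum M) == index s (enum M)) = (g == s).
    by move=> sM gM; rewrite -val_eqE /= !eqn_leq !index_enum_leq.
  case: (boolP (g \in M)) => gM /=; first by rewrite -(idx s1) // -(idx s2) // i1 i2.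
  by apply/esym/norP; split; apply: contraNneq gM => ->.
(* Since [a] declined [S_1] and [S_3], the two goods are worth less than [tau] and [tau / 3]. *)
have y12 : y s1 + y s2 <= 1 + t.
  rewrite -e1 -e2; have := lt' 0%N isT; have := lt' 2%N isT => /=.
  have h1 : val_at y M (2 * #|N|)%N <= val_at y M (2 * #|N|).-1.
    by apply: val_at_y_noninc => //; rewrite leq_pred.
  have h2 : val_at y M (2 * #|N|).-1 <= val_at y M (2 * #|N|).-2.
    by apply: val_at_y_noninc => //; rewrite leq_pred.
  by move: h1 h2 tt; lra.
case: (eqVneq (col s1) (col s2)) => [c12|c12]; last exact: (packing_merge pk s1M s2M c12 y12).
apply: weaken; have [colK _ _ _] := pk.
apply: (packing_remove_class K2 pk (subxx _) _ _ (colK s1)).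
- by apply/subsetP => g; rewrite !inE => /orP[] /eqP ->.
- by move=> s u _; rewrite setDv inE.
apply: subset_leq_card; apply/subsetP => g; rewrite !inE => /orP[] /eqP ->.
  by rewrite !eqxx.
by rewrite c12 !eqxx orbT.
Qed.

Lemma satisfied_by_packing (rule : choice_rule n m) (d : R) :
  0 <= d -> d <= 1 / 24 -> n%:R * (4 / 3 * d) <= 1 / 9 -> tau a = 3 / 4 + d ->
  tau a <= v a (alloc2 (phase2 v tau rule (phase1 v tau)) a).
Proof.
(* With this [t], [1 + t] is [4/3 * tau], the bound on a type-4 bundle. *)
move=> d0 d1 nd taud; set t := 4 / 3 * d in nd.
have t0 : 0 <= t by rewrite /t; lra.
have tt : tau a * 4 / 3 <= 1 + t by rewrite taud /t; lra.
have Inv0 : packed t setT setT.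
  exists setT, cls, y; split.
  - by rewrite !cardsT.
  - split=> [g|g|g|l _]; [by rewrite inE | exact: y_ge0 | by rewrite inE |].
    by rewrite le_eqVlt (cls1 l : \sum_(g | cls g == l) y g = 1) eqxx.
  rewrite cardsT card_ord subrr mul0r subr0 (partition_big cls xpredT) //=.
  by rewrite (eq_bigr (fun=> 1)) ?sumr_const ?card_ord // => l _; apply: cls1.
have InvS (N : {set 'I_n}) (M : {set 'I_m}) (k : 'I_4) i :
     a \in N -> i \in N -> i != a -> packed t N M ->
     (forall k' : 'I_4, (k' < k)%N -> v a (reduction_bundle N M k') < tau a) ->
     ((a < i)%N -> v a (reduction_bundle N M k) < tau a) ->
     packed t (N :\ i) (M :\: reduction_bundle N M k).
  by move=> aN iN ia inv lt_k _; apply: packed_step.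
have Invne (N : {set 'I_n}) : a \in N -> ~ packed t N set0.
  move=> aN [K [col [z [cK [_ _ zy _] tot]]]].
  have N1 : 1 <= #|N|%:R :> R by rewrite ler1n; apply/card_gt0P; exists a.
  have : \sum_g z g <= 0 by apply: sumr_le0 => g _; have := zy g; rewrite inE.
  by have := mulr_ge0 (ler0n R #|N|) t0; lra.
case: (phase1_invariant Inv0 InvS Invne) => [[aN ta]|[aN inv stuck]].
  exact: phase2_kept.
apply: phase2_satisfies => // B [sumB topB _ [j0 j0C Bj0]].
move: (phase1 v tau) aN inv stuck sumB topB j0C => [N M A] /= aN inv stuck sumB topB j0C.
have N0 : (0 < #|N|)%N by apply/card_gt0P; exists a.
have NR : #|N|%:R <= n%:R :> R by rewrite ler_nat -[X in (_ <= X)%N]card_ord max_card.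
have stuck' k : (k < 4)%N -> bundle_val #|N| (val_at y M) k < tau a.
  by move=> k4; have := stuck (Ordinal k4); rewrite (bundle_valE v_add).
have s1 := stuck' 1%N isT; have s2 := stuck' 2%N isT; have s3 := stuck' 3%N isT.
case: inv => K [col [z [cK [colK z0 zy cls_le] tot]]].
have [p [pzy pord]] := sorting_perm v_ord zy.
pose z' g := z (p g); pose G := val_at z' M.
have zy' g : g \in M -> z' g <= y g by move=> gM; have := pzy g; rewrite gM.
have z'0 g : 0 <= z' g by apply: z0.
have z'M g : g \notin M -> z' g = 0.
  move=> gM; apply/eqP; rewrite eq_le z'0 andbT; have := pzy g.
  by rewrite (negbTE gM).
have zyall g : z' g <= y g by case: (boolP (g \in M)) => [/zy'|/z'M ->].
have Gf j : G j <= val_at y M j by apply: le_val_at.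
have G0 j : 0 <= G j by apply: val_at_ge0.
have Gni i j : (i <= j)%N -> G j <= G i.
  by apply: val_at_noninc => // g h gM hM; apply: pord.
have fni := @val_at_y_noninc R n m v a v_add v_ord M.
have [k0 k0K] : exists k, k \in K by apply/card_gt0P; rewrite cK.
(* Positions beyond [#|M|] have value 0 and class [k0]; [L] exceeds [2 * #|N|] whatever the size of
   [M]. *)
pose colp i := nth k0 [seq col (p g) | g <- enum M] i.
pose L := (#|M| + (2 * #|N|).+1)%N.
pose F i := if insub i is Some j then \sum_(g in B j) z' g else 0.
have FE (j : 'I_n) : F j = \sum_(g in B j) z' g by rewrite /F valK.
have SM : \sum_(g in M) z' g = \sum_g z g.
  rewrite [RHS](reindex_inj (@perm_inj _ p)) /= [RHS](bigID (mem M)) /=.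
  by rewrite [X in _ = _ + X]big1 ?addr0 // => g /z'M.
have FS : \sum_(0 <= j < #|N|) F j = \sum_g z g.
  have cN : (#|N| <= n)%N by rewrite -[X in (_ <= X)%N]card_ord max_card.
  rewrite -SM -sumB -(big_range_ord 0 xpredT F cN).
  by apply: eq_big => j; rewrite ?inE ?andbT // => _; apply: FE.
suff : \sum_(0 <= j < #|N|) F j < #|N|%:R - (n%:R - #|N|%:R) * t.
  by rewrite FS; move: tot; lra.
rewrite inE in j0C.
apply: (@bags_total_lt R _ K #|N| L G colp F d _ j0) => //.
- move=> i; case: (ltnP i #|M|) => iM; last by rewrite /colp nth_default // size_map -cardE.
  have : all (mem K) [seq col (p g) | g <- enum M] by apply/allP => l /mapP[g _ ->]; apply: colK.
  by move/all_nthP; apply; rewrite size_map -cardE.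
- move=> l lK; apply: le_trans (cls_le l lK).
  rewrite [X in _ <= X](reindex_inj (@perm_inj _ p)) /= big_mkcond /=.
  rewrite -(big_mkord xpredT (fun i => if colp i == l then G i else 0)).
  rewrite (eq_big_nat _ _ (F2 := val_at (fun g => if col (p g) == l then z' g else 0) M)).
    rewrite -sum_val_at; last by rewrite leq_addr.
    rewrite big_mkcond [X in _ <= X]big_mkcond /=; apply: ler_sum => g _.
    by case: (g \in M); case: (col _ == l).
  move=> i _; case: (ltnP i #|M|) => iM; last first.
    by rewrite /G !val_at_default // if_same.
  have [g [gM gi] ->] := val_atP (fun g => if col (p g) == l then z' g else 0) iM.
  rewrite /G -gi val_at_index // /colp (nth_map g) ?index_mem ?mem_enum //.
  by rewrite nth_index ?mem_enum.
- by rewrite /L -[X in (X < _)%N]add0n -addnS leq_add.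
- by rewrite -taud; apply: le_lt_trans s1; apply: lerD.
- rewrite -taud; apply: le_lt_trans s2 => /=.
  have h1 := fni _ _ (leq_pred (2 * #|N|)); have h2 := fni _ _ (leq_pred (2 * #|N|).-1).
  by have := Gf (2 * #|N|)%N; move: h1 h2; lra.
- by rewrite -taud; apply: le_lt_trans s3; apply: lerD.
- move=> j jN; have cN : (#|N| <= n)%N by rewrite -[X in (_ <= X)%N]card_ord max_card.
  pose j' := Ordinal (leq_trans jN cN); have := topB j'; rewrite inE => /(_ jN).
  rewrite -[j]/(nat_of_ord j') FE => -[->|[g [B' [gG gB' -> B't]]]].
    by left; rewrite sum_base_bag.
  right; rewrite big_setU1 //= addrC -taud; apply: ltr_leD.
    apply: le_lt_trans B't; rewrite vE.
    by apply: ler_sum => h _; apply: zyall.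
  have [gM ge] := off_base_index gG.
  by rewrite -(val_at_index z' gM); apply: Gni.
- rewrite FE -taud; apply: le_lt_trans Bj0; rewrite vE.
  by apply: ler_sum => g _; apply: zyall.
- by rewrite mulr_ge0 // subr_ge0.
by rewrite -/t; lra.
Qed.

End Agent.

(** * Conclusion *)

Section Guarantee.
Variables (R : realFieldType) (n m : nat) (v : 'I_n -> {set 'I_m} -> R).
Hypotheses (v_add : forall i, additive_valuation (v i)).
Hypotheses (v_ord : ordered v) (v_norm : normalized v).

Lemma normalized_classes i : exists cls : 'I_m -> 'I_n,
  forall l, \sum_(g | cls g == l) v i [set g] = 1.
Proof.
have [P [/andP[/eqP cover /forallP disj] P1]] := v_norm i.
have [_ vE] := v_add i.
exists (fun g => odflt i [pick j | g \in P j]) => l.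
rewrite -(P1 l) [RHS]vE; apply: eq_bigl => g.
have : g \in \bigcup_j P j by rewrite cover inE.
case/bigcupP => j _ gj; case: pickP => [k /= gk|/(_ j)]; last by rewrite gj.
apply/eqP/idP => [<-//|gl]; apply/eqP; apply: contraT => kl.
have /forallP/(_ l)/implyP/(_ kl) := disj k.
by rewrite disjoint_subset => /subsetP/(_ _ gk); rewrite inE gl.
Qed.

(** The [n] bundles of a partition have total value [n], so the least of them is worth at most 1. *)
Lemma MMS_le1 i : (0 < n)%N -> MMS n (v i) <= 1.
Proof.
move=> n0; have [cls cls1] := normalized_classes i.
have tot : v i [set: 'I_m] = n%:R := total_value (v_add i) cls1.
have [v0 vE] := v_add i.
rewrite /MMS; apply: (big_rec (fun x => x <= 1)) => [|P x Ppart x1]; first exact: ler01.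
rewrite ge_max x1 andbT; set mn := \big[_/_]_(j < n) _.
have le j : mn <= v i (P j) := (@bigmin_le _ _ _ _ j (fun k => v i (P k))).
have : mn * n%:R <= n%:R.
  rewrite -[X in _ <= X]tot.
  have -> : v i [set: 'I_m] = \sum_j v i (P j).
    have /andP[/eqP cover /forallP disj] := Ppart.
    rewrite vE -cover partition_disjoint_bigcup => [|j k jk]; last first.
      by have /forallP/(_ k)/implyP/(_ jk) := disj j.
    by apply: eq_bigr => j _; rewrite -vE.
  rewrite mulr_natr -[n in _ *+ n]card_ord -sumr_const.
  by apply: ler_sum.
by rewrite -[X in _ <= X]mul1r ler_pM2r ?ltr0n.
Qed.

Lemma RBF_threshold (rule : {perm 'I_n} -> choice_rule n m) (sigma : {perm 'I_n}) i :
  threshold R (sigma i) <= v i (RBF rule v (@threshold R n) sigma i).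
Proof.
have n0 : (0 < n)%N by apply: leq_ltn_trans (ltn_ord i).
have nR : 0 < n%:R :> R by rewrite ltr0n.
rewrite /RBF ffunE; set w := fun r : 'I_n => v _.
have wE : w (sigma i) = v i by rewrite /w permK.
rewrite -wE; have [cls cls1] := normalized_classes i.
have w_add : additive_valuation (w (sigma i)) by rewrite wE.
have w_ord (g h : 'I_m) : (g <= h)%N -> w (sigma i) [set h] <= w (sigma i) [set g].
  by rewrite wE; apply: v_ord.
have w_cls l : \sum_(g | cls g == l) w (sigma i) [set g] = 1 by rewrite wE.
set a := sigma i in w_add w_ord w_cls *.
have nE : (12 * n)%:R = 12 * n%:R :> R by rewrite natrM.
have n2E : (2 * n)%:R = 2 * n%:R :> R by rewrite natrM.
have d0 : 0 < 1 / (12 * n)%:R :> R by rewrite nE divr_gt0 //; lra.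
have a0 : 0 <= a%:R :> R by rewrite ler0n.
have tE : threshold R a = Num.max (2 * n%:R / (2 * n%:R + a%:R)) (3 / 4 + 1 / (12 * n)%:R).
  by rewrite /threshold natrD natrM.
case: (lerP (3 / 4 + 1 / (12 * n)%:R) (2 * n%:R / (2 * n%:R + a%:R) : R)) => cmp.
  have t : threshold R a = 2 * n%:R / (2 * n%:R + a%:R) by rewrite tE; apply/max_idPl.
  apply: (satisfied_by_priority w_add w_ord w_cls); rewrite t.
  - by move: cmp d0; lra.
  - by rewrite ler_pdivrMr ?mul1r; lra.
  rewrite le_eqVlt; apply/orP; left; apply/eqP; field.
  by rewrite gt_eqF //; lra.
have t : threshold R a = 3 / 4 + 1 / (12 * n)%:R by rewrite tE; apply/max_idPr/ltW.
(* For [n = 1] the first term of the threshold is 1 and dominates. From [n >= 2] follows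
   [d <= 1/24]. *)
have n2 : (2 <= n)%N.
  rewrite ltn_neqAle n0 andbT; apply/eqP => n1; move: cmp.
  have an := ltn_ord a; have -> : (a : nat) = 0%N by lia.
  by rewrite -n1 addr0 muln1 mulr1 divff; lra.
have n2R : 2 <= n%:R :> R by rewrite (ler_nat R 2).
apply: (satisfied_by_packing w_add w_ord w_cls _ (ltW d0) _ _ t).
  by rewrite nE ler_pdivrMr; lra.
rewrite le_eqVlt; apply/orP; left; apply/eqP; rewrite nE; field.
by rewrite gt_eqF.
Qed.
End Guarantee.

(** The rank is symmetric in agent and shift, so for a fixed agent it runs through all ranks as the
    shift varies. *)
Lemma sum_cyclic_rank (R : nmodType) n (F : 'I_n -> R) i :
  \sum_(k < n) F (priority k i) = \sum_r F r.
Proof.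
rewrite [RHS](reindex_inj (@cyclic_rank_inj n i)); apply: eq_bigr => k _.
congr F; rewrite permE; apply: val_inj => /=.
by rewrite addnC.
Qed.

(** The concave function [ln] lies below its tangent at [x]. *)
Lemma ln_diff_le (R : realType) (x y : R) : 0 < x -> 0 < y -> ln y - ln x <= (y - x) / x.
Proof.
move=> x0 y0; have := @le_ln1Dx R (y / x - 1).
have -> : 1 + (y / x - 1) = y / x by rewrite addrC subrK.
rewrite ln_div ?posrE //; have -> : y / x - 1 = (y - x) / x by rewrite mulrBl divff ?gt_eqF.
apply; have : 0 < y / x by rewrite divr_gt0.
by rewrite mulrBl divff ?gt_eqF //; lra.
Qed.

Lemma sum_threshold (R : realType) n : (0 < n)%N ->
  n%:R * (2 * ln (4 / 3) + 1 / 4 + 1 / (36 * n)%:R) <= \sum_(r < n) threshold R r.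
Proof.
move=> n0; have nR : 0 < n%:R :> R by rewrite ltr0n.
set N := n%:R in nR *.
pose A : R := 3 / 4 + 1 / (12 * N).
(* [Psi] is an antiderivative of the function that is 2n/(2n+x) up to x = 2n/3 and
   the constant threshold [A] afterwards. *)
pose Psi (x : R) := 2 * N * ln (Num.min (2 * N + x) (8 / 3 * N)) +
  A * Num.max (x - 2 / 3 * N) 0.
have step (r : nat) : (r < n)%N ->
    Psi r.+1%:R - Psi r%:R <= Num.max (2 * N / (2 * N + r%:R)) A.
  move=> _; have r0 : 0 <= r%:R :> R by rewrite ler0n.
  rewrite /Psi -[r.+1%:R]natr1; set x : R := r%:R in r0 *.
  have lnd y : 0 < y -> 2 * N * ln y - 2 * N * ln (2 * N + x) <=
      2 * N / (2 * N + x) * (y - (2 * N + x)).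
    move=> y0; rewrite -mulrBr.
    have x0 : 0 < 2 * N + x by lra.
    have := ln_diff_le x0 y0 => h.
    rewrite -mulrA [_^-1 * _]mulrC ler_wpM2l //; lra.
  set p := 2 * N / (2 * N + x) in lnd *.
  (* The break point [2n/3], where [2n / (2n + x)] equals [3/4], lies to the right of [[x, x + 1]],
     to its left, or inside. *)
  case: (lerP (x + 1) (2 / 3 * N)) => h1.
    rewrite (@min_l _ _ (2 * N + (x + 1))); last by lra.
    rewrite (@min_l _ _ (2 * N + x)); last by lra.
    rewrite (@max_r _ _ (x + 1 - _)); last by lra.
    rewrite (@max_r _ _ (x - _)); last by lra.
    rewrite le_max; apply/orP; left.
    by have := lnd (2 * N + (x + 1)) ltac:(lra); lra.
  case: (lerP (2 / 3 * N) x) => h2.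
    rewrite (@min_r _ _ (2 * N + (x + 1))); last by lra.
    rewrite (@min_r _ _ (2 * N + x)); last by lra.
    rewrite (@max_l _ _ (x + 1 - _)); last by lra.
    rewrite (@max_l _ _ (x - _)); last by lra.
    by rewrite le_max; apply/orP; right; lra.
  rewrite (@min_r _ _ (2 * N + (x + 1))); last by lra.
  rewrite (@min_l _ _ (2 * N + x)); last by lra.
  rewrite (@max_l _ _ (x + 1 - _)); last by lra.
  rewrite (@max_r _ _ (x - _)); last by lra.
  (* Up to the break point [Psi] has slope at most [p], and [A] afterwards; neither exceeds the
     maximum. *)
  have := lnd (8 / 3 * N) ltac:(lra).
  have pm : p <= Num.max p A by rewrite le_max lexx.
  have Am : A <= Num.max p A by rewrite le_max lexx orbT.
  move: (Num.max p A) pm Am => t pm Am.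
  have : p * (8 / 3 * N - (2 * N + x)) <= t * (8 / 3 * N - (2 * N + x)).
    by apply: ler_wpM2r => //; lra.
  have : A * (x + 1 - 2 / 3 * N) <= t * (x + 1 - 2 / 3 * N).
    by apply: ler_wpM2r => //; lra.
  lra.
have tele : Psi N - Psi 0 <= \sum_(r < n) threshold R r.
  rewrite -(big_mkord xpredT (fun r => Num.max ((2 * n)%:R / (2 * n + r)%:R) (3 / 4 + 1 / (12 * n)%:R))).
  have <- : \sum_(0 <= r < n) (Psi r.+1%:R - Psi r%:R) = Psi N - Psi 0.
    exact: (telescope_sumr (fun r => Psi r%:R) (leq0n n)).
  rewrite !big_nat; apply: ler_sum => r /andP[_ rn].
  by apply: le_trans (step r rn) _; rewrite natrD !natrM -/N.
apply: le_trans tele; rewrite /Psi.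
rewrite min_r; last by lra.
rewrite min_l; last by lra.
rewrite max_l; last by lra.
rewrite max_r; last by lra.
have -> : ln (4 / 3) = ln (8 / 3 * N) - ln (2 * N + 0) :> R.
  rewrite -ln_div ?posrE; [|lra|lra]; congr ln; field.
  by rewrite gt_eqF.
(* The linear part of [Psi] contributes [A * N / 3 = N * (1/4 + 1/(36 N))]. *)
rewrite le_eqVlt; apply/orP; left; apply/eqP; rewrite /A natrM -/N; field.
by rewrite gt_eqF.
Qed.

Theorem theorem7 (R : realType) (n m : nat) (hn : (1 <= n)%N)
    (v : 'I_n -> {set 'I_m} -> R)
    (hv : forall i, additive_valuation (v i))
    (hord : ordered v) (hnorm : normalized v)
    (rule : {perm 'I_n} -> choice_rule n m) :
  let A := fun k : 'I_n => RBF rule v (@threshold R n) (priority k) in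
  ex_post_MMS v A (3 / 4 + 1 / (12 * n)%:R) /\
  ex_ante_MMS v A (2 * ln (4 / 3) + 1 / 4 + 1 / (36 * n)%:R).
Proof.
move=> A; have nR : 0 < n%:R :> R by rewrite ltr0n.
have geT k i : threshold R (priority k i) <= v i (A k i).
  exact: RBF_threshold hv hord hnorm rule (priority k) i.
have MMS1 i : MMS n (v i) <= 1 := MMS_le1 hv hnorm i hn.
have ge0 k : 0 <= 1 / (k.+1 * n)%:R :> R by rewrite divr_ge0.
split=> [k i|i].
  apply: le_trans (geT k i); apply: (@le_trans _ _ (3 / 4 + 1 / (12 * n)%:R)).
    by rewrite ler_piMr //; have := ge0 11%N; lra.
  by rewrite /threshold le_max lexx orbT.
have sumT := sum_threshold R hn.
have sumv : \sum_(r < n) threshold R r <= \sum_(k < n) v i (A k i).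
  by rewrite -(sum_cyclic_rank _ i); apply: ler_sum => k _; apply: geT.
apply: (@le_trans _ _ (2 * ln (4 / 3) + 1 / 4 + 1 / (36 * n)%:R)).
  rewrite ler_piMr //; have := ge0 35%N; have : 0 <= ln (4 / 3) :> R.
    by rewrite ln_ge0 //; lra.
  lra.
rewrite ler_pdivlMr // mulrC; exact: le_trans sumT sumv.
Qed.
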